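(* Let $T>0$, $d,e\in\mathbb{N}^*$, $\alpha,\beta\in\,]0,1]$ with $\alpha+\beta>1$, $F\in \mathrm{C}^{\alpha\text{-H\''ol}}([0,T];\mathcal{P}_{\mathrm{ck}}(M_{e,d}(\mathbb{R})))$ and $w\in \mathrm{C}^{\beta\text{-H\''ol}}([0,T];\mathbb{R}^d)$. For every real $r\geqslant r_{\min}$, the Aumann–Young integral $J_{T,\alpha,r}(F,w)$ of $F$ with respect to $w$ and parameters $\alpha$ and $r$ is a nonempty, bounded, closed and convex subset of $\mathbb{R}^e$.
   Context: $M_{e,d}(\mathbb{R})$ is the space of real $e\times d$ matrices, identified with $\mathbb{R}^{ed}$ with Euclidean norm $\|\cdot\|$. For $E=\mathbb{R}^m$, $\mathcal{P}_{\mathrm{ck}}(E)$ is the set of nonempty convex compact subsets of $E$, and $d_{\mathrm{H}}$ is the Hausdorff distance. Demyanov distance: for $C\in\mathcal{P}_{\mathrm{ck}}(E)$ and $l\in E$ let $Y(l,C)=\{c\in C:\langle l,c\rangle=\max_{x\in C}\langle l,x\rangle\}$; if $Y(l,C)$ is a singleton its element is denoted $y(l,C)$ and $l$ is called an exposing direction of $C$; $\mathcal{T}_C$ is the set of exposing directions of $C$. Then $d_{\mathrm{D}}(A,B)=\sup\{\|y(l,A)-y(l,B)\| : l\in\mathcal{T}_A\cap\mathcal{T}_B\}$. Steiner constant: $\mathrm{St}(C)=\frac1{v_m}\int_{\mathcal{T}_C\cap B(0,1)}y(x,C)\,dx$ for $C\in\mathcal{P}_{\mathrm{ck}}(\mathbb{R}^m)$,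 where $B(0,1)$ is the unit ball of $\mathbb{R}^m$ and $v_m$ its volume. The map $\mathrm{St}:(\mathcal{P}_{\mathrm{ck}}(\mathbb{R}^m),d_{\mathrm{H}})\to\mathbb{R}^m$ is Lipschitz, and $\mathfrak{k}_m$ denotes its sharp (smallest) Lipschitz constant. $\|F\|_{\alpha,T}=\sup_{s<t}d_{\mathrm{H}}(F(s),F(t))/|t-s|^\alpha$; $\mathrm{C}^{\alpha\text{-H\''ol}}$ is the set of maps with $\|\cdot\|_{\alpha,T}<\infty$ (same notation for point-valued functions, with the norm distance); $\|F\|_{\alpha,T,\mathrm{Dem}}\in[0,+\infty]$ is defined like $\|F\|_{\alpha,T}$ with $d_{\mathrm{D}}$ instead of $d_{\mathrm{H}}$. $r_{\min}=\min(\mathfrak{k}_{ed}\|F\|_{\alpha,T},\ \|F\|_{\alpha,T,\mathrm{Dem}})$. $\mathcal{S}_{\alpha,r}(F)$ is the set of measurable $f:[0,T]\to M_{e,d}(\mathbb{R})$ with $f(t)\in F(t)$ for all $t$ and $\|f\|_{\alpha,T}\leqslant r$. The Aumann–Young integral is $J_{T,\alpha,r}(F,w)=\{\int_0^Tf(t)\,dw(t) : f\in\mathcal{S}_{\alpha,r}(F)\}$, where $\int_0^Tf\,dw$ is the Young integral (limit of Riemann sums $\sum_kf(t_k)(w(t_{k+1})-w(t_k))$ as the mesh of the dissection of $[0,T]$ tends to $0$). *)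

(* Defs.v *)
From HB Require Import structures.
From mathcomp Require Import all_boot all_order all_algebra.
From mathcomp Require Import all_classical all_reals all_analysis.

Set Implicit Arguments.
Unset Strict Implicit.
Unset Printing Implicit Defensive.

Import Order.TTheory GRing.Theory Num.Theory.
Import numFieldNormedType.Exports.

Local Open Scope classical_set_scope.
Local Open Scope ring_scope.

(* The norm `|A| that the library puts on matrices is the sup norm; metric
   notions below use the Euclidean norm [enorm] instead. *)
Section euclidean.
Context {R : realType} {m n : nat}.
Implicit Types A B : 'M[R]_(m, n).

Definition dotm A B : R := \sum_i \sum_j A i j * B i j.

Definition enorm A : R := Num.sqrt (dotm A A).

Definition edistm A B : \bar R := (enorm (A - B))%:E.

End euclidean.

Section convex_compact.
Context {R : realType} {m n : nat}.
Implicit Types A B C : set 'M[R]_(m, n).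

Definition Pck : set (set 'M[R]_(m, n)) :=
  [set C | [/\ C !=set0, convex_set (C : set (convex_lmodType 'M[R]_(m, n)))
             & compact C]].

Definition hausdorff_dist A B : \bar R :=
  maxe (ereal_sup [set ereal_inf [set edistm a b | b in B] | a in A])
       (ereal_sup [set ereal_inf [set edistm a b | a in A] | b in B]).

Definition exposed_face (l : 'M[R]_(m, n)) C : set 'M[R]_(m, n) :=
  [set c | C c /\ forall x, C x -> dotm l x <= dotm l c].

Definition exposing_directions C : set 'M[R]_(m, n) :=
  [set l | exists c, exposed_face l C = [set c]].

(* Meaningful for [l] in [exposing_directions C] only. *)
Definition exposed_point (l : 'M[R]_(m, n)) C : 'M[R]_(m, n) :=
  xget 0 (exposed_face l C).

Definition demyanov_dist A B : \bar R :=
  ereal_sup [set edistm (exposed_point l A) (exposed_point l B) |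
             l in exposing_directions A `&` exposing_directions B].

End convex_compact.

(* Lebesgue measure on R^m, carried by m.-tuple R with the product
   sigma-algebra, as the m-fold product of the Lebesgue measure on R. *)
Section lebesgue_cons.
Context {R : realType} {m : nat}.
Variable mu : {sigma_finite_measure set (m.-tuple (measurableTypeR R)) -> \bar R}.
Local Open Scope ereal_scope.

Definition consp (p : measurableTypeR R * m.-tuple (measurableTypeR R)) :
  m.+1.-tuple (measurableTypeR R) := [tuple of p.1 :: p.2].

Lemma measurable_consp : measurable_fun setT consp.
Proof. exact: measurable_cons measurable_fst measurable_snd. Qed.

Definition lebesgue_cons : set (m.+1.-tuple (measurableTypeR R)) -> \bar R :=
  pushforward (@lebesgue_measure R \x mu) consp.

Let pf : {measure set (m.+1.-tuple (measurableTypeR R)) -> \bar R} :=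
  measure_function_pushforward__canonical__measure_function_Measure
    (@lebesgue_measure R \x mu) measurable_consp.

Let lebesgue_cons0 : lebesgue_cons set0 = 0.
Proof. exact: (measure0 pf). Qed.

Let lebesgue_cons_ge0 A : 0 <= lebesgue_cons A.
Proof. exact: (measure_ge0 pf). Qed.

Let lebesgue_cons_sigma_additive : semi_sigma_additive lebesgue_cons.
Proof. exact: (@measure_semi_sigma_additive _ _ _ pf). Qed.

HB.instance Definition _ := isMeasure.Build _ _ _ lebesgue_cons
  lebesgue_cons0 lebesgue_cons_ge0 lebesgue_cons_sigma_additive.

Let lebesgue_cons_sigma_finite : sigma_finite setT lebesgue_cons.
Proof.
have /sigma_finiteP[F [FT ndF Foo]] := sigma_finiteT (@lebesgue_measure R).
have /sigma_finiteP[G [GT ndG Goo]] := sigma_finiteT mu.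
pose H k := (@tnth _ _ ^~ ord0) @^-1` F k `&`
  (fun t : m.+1.-tuple (measurableTypeR R) => [tuple of behead t]) @^-1` G k.
exists H => [|k].
  apply/esym; rewrite -subTset => t _.
  have [i _ Fi] : (\bigcup_k F k) (tnth t ord0) by rewrite -FT.
  have [j _ Gj] : (\bigcup_k G k) [tuple of behead t] by rewrite -GT.
  exists (maxn i j) => //; split => /=.
    by move: Fi; exact/subsetPset/ndF/leq_maxl.
  by move: Gj; exact/subsetPset/ndG/leq_maxr.
have [mF Fk] := Foo k; have [mG Gk] := Goo k; split.
  apply: measurableI; rewrite -[X in measurable X]setTI.
    exact: measurable_tnth.
  exact: measurable_behead.
rewrite /lebesgue_cons /pushforward (_ : _ @^-1` _ = F k `*` G k).
  by rewrite product_measure1E// lte_mul_pinfty// ge0_fin_numE.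
have E x t : [tuple of behead (consp (x, t))] = t by exact: val_inj.
apply/seteqP; split=> -[x t] [Fx Gt]; split; [exact: Fx| |exact: Fx|].
  by rewrite -(E x t).
by rewrite /preimage/= E.
Qed.

HB.instance Definition _ := Measure_isSigmaFinite.Build _ _ _ lebesgue_cons
  lebesgue_cons_sigma_finite.

End lebesgue_cons.

Fixpoint lebesgue_tuple {R : realType} (m : nat) :
    {sigma_finite_measure set (m.-tuple (measurableTypeR R)) -> \bar R} :=
  if m is m'.+1 then lebesgue_cons (lebesgue_tuple m')
  else \d_[tuple].

Section steiner.
Context {R : realType} (m : nat).

Definition row_of_tuple (t : m.-tuple R) : 'rV[R]_m := \row_j tnth t j.

Definition unit_ball : set 'rV[R]_m := [set x | enorm x <= 1].

Definition unit_ball_volume : R :=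
  fine (lebesgue_tuple m (row_of_tuple @^-1` unit_ball)).

Definition steiner (C : set 'rV[R]_m) : 'rV[R]_m :=
  \row_j (unit_ball_volume^-1 *
    \int[lebesgue_tuple m]_(t in
        row_of_tuple @^-1` (exposing_directions C `&` unit_ball))
      exposed_point (row_of_tuple t) C ord0 j).

(* Extended-real valued, so that no Lipschitz estimate is presupposed. *)
Definition steiner_lipschitz_constant : \bar R :=
  ereal_inf [set k%:E | k in [set k : R | 0 <= k /\
    forall A B : set 'rV[R]_m, Pck A -> Pck B ->
      (edistm (steiner A) (steiner B) <= k%:E * hausdorff_dist A B)%E]].

End steiner.

Section hoelder.
Context {R : realType} {X : Type}.

Definition hoelder_seminorm (dist : X -> X -> \bar R) (alpha T : R)
    (F : R -> X) : \bar R :=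
  ereal_sup [set (dist (F st.1) (F st.2) * ((st.2 - st.1) `^ alpha)^-1%:E)%E |
             st in [set st : R * R | [/\ 0 <= st.1, st.1 < st.2 & st.2 <= T]]].

End hoelder.

Section young.
Context {R : realType} {d e : nat}.

(* A dissection 0 = t_0 < ... < t_n = T is given by s = [:: t_1; ...; t_n]. *)
Definition mesh (T : R) (s : seq R) : R :=
  \big[Num.max/0]_(k < size s) (nth T (0 :: s) k.+1 - nth T (0 :: s) k).

Definition mesh_to0 (T : R) : set_system (seq R) :=
  [set P | exists2 delta : R, 0 < delta &
    forall s, itv_partition 0 T s -> mesh T s < delta -> P s].

#[global] Instance mesh_to0_filter (T : R) : Filter (mesh_to0 T).
Proof.
split=> [|P Q [p p0 Pp] [q q0 Qq]|P Q PQ [p p0 Pp]].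
- by exists 1.
- exists (Num.min p q) => [|s sT]; first by rewrite lt_min p0.
  by rewrite lt_min => /andP[sp sq]; split; [exact: Pp|exact: Qq].
- by exists p => // s sT sp; exact/PQ/Pp.
Qed.

Definition riemann_sum (f : R -> 'M[R]_(e, d)) (w : R -> 'cV[R]_d) (T : R)
    (s : seq R) : 'cV[R]_e :=
  let t := nth T (0 :: s) in
  \sum_(0 <= k < size s) f (t k) *m (w (t k.+1) - w (t k)).

Definition is_young_integral (f : R -> 'M[R]_(e, d)) (w : R -> 'cV[R]_d)
    (T : R) (I : 'cV[R]_e) : Prop :=
  riemann_sum f w T @ mesh_to0 T --> I.

Definition hoelder_selections (T alpha r : R) (F : R -> set 'M[R]_(e, d)) :
    set (R -> 'M[R]_(e, d)) :=
  [set f | [/\ measurable_fun `[0, T]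
                 (f : R -> g_sigma_algebraType (@open 'M[R]_(e, d))),
              forall t, t \in `[0, T] -> F t (f t)
            & (hoelder_seminorm edistm alpha T f <= r%:E)%E]].

Definition aumann_young (T alpha r : R) (F : R -> set 'M[R]_(e, d))
    (w : R -> 'cV[R]_d) : set 'cV[R]_e :=
  [set I | exists2 f, hoelder_selections T alpha r F f &
                      is_young_integral f w T I].

Definition rmin (T alpha : R) (F : R -> set 'M[R]_(e, d)) : \bar R :=
  mine (steiner_lipschitz_constant (e * d) *
          hoelder_seminorm hausdorff_dist alpha T F)%E
       (hoelder_seminorm demyanov_dist alpha T F).

End young.

(* Main.v *)
(* The Steiner selection [t |-> St(F(t))] shows that J is nonempty. By
   monotonicity of the faces of C, on each line parallel to a coordinate axis
   only countably many directions have a face that is not constant in that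
   coordinate, so by Fubini almost every direction exposes C. Hence St(C) is a
   mean of points of C over the whole unit ball: it lies in C, and St(A) - St(B)
   is a mean of vectors y(l,A) - y(l,B), of norm at most the Demyanov distance.

   The sewing estimate compares Riemann sums with the Young integral uniformly
   over the selections with Hoelder constant r. Boundedness follows at once.
   For closedness, Tychonoff's theorem gives a pointwise accumulation point of
   selections, and the uniform estimate lets the integral pass to the limit.
   Convexity holds since selections form a convex set and the integral is
   linear. *)
Require Import Defs.
From mathcomp Require Import all_boot all_order all_algebra.
From mathcomp Require Import all_classical all_reals all_analysis.
From mathcomp Require Import measurable_realfun.
From mathcomp Require Import ring lra.
Import Order.TTheory GRing.Theory Num.Theory.
Import numFieldNormedType.Exports.
Local Open Scope classical_set_scope.
Local Open Scope ring_scope.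
Set Implicit Arguments.
Unset Strict Implicit.

(** * Euclidean norm on matrices *)

(** In the Hausdorff branch of [rmin], the Lipschitz constant is an infimum; for fixed times the
    normalised distance of two Steiner points lies below every admissible constant, hence below the
    infimum. A vanishing Hausdorff seminorm is treated apart, with a constant selection. In the
    Demyanov branch, the integrals defining St(A) and St(B) run over different sets of directions;
    they can be subtracted because the directions missing from either set form a null set. As y(l,C)
    is the gradient at l of the support function of C, this is almost everywhere differentiability
    of a convex function, and the monotonicity used is that of its subdifferential. Two norms
    coexist. The sup norm carries the topology and the Young estimates, where constants are free.
    The Hoelder bound [r] of selections is Euclidean and has to survive convex combinations and
    limits without loss. Pointwise accumulation is enough for closedness because a Riemann sum
    involves finitely many values of the integrand. *)

Section euclidean_norm.
Context {R : realType} {m n : nat}.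
Implicit Types (A B C : 'M[R]_(m, n)) (a : R).

Lemma dotmC A B : dotm A B = dotm B A.
Proof. by apply: eq_bigr => i _; apply: eq_bigr => j _; rewrite mulrC. Qed.

Lemma dotmDl A B C : dotm (A + B) C = dotm A C + dotm B C.
Proof.
rewrite /dotm -big_split; apply: eq_bigr => i _ /=; rewrite -big_split.
by apply: eq_bigr => j _; rewrite mxE mulrDl.
Qed.

Lemma dotmZl a A B : dotm (a *: A) B = a * dotm A B.
Proof.
rewrite /dotm mulr_sumr; apply: eq_bigr => i _; rewrite mulr_sumr.
by apply: eq_bigr => j _; rewrite mxE mulrA.
Qed.

Lemma dotmNl A B : dotm (- A) B = - dotm A B.
Proof. by rewrite -scaleN1r dotmZl mulN1r. Qed.

Lemma dotmBl A B C : dotm (A - B) C = dotm A C - dotm B C.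
Proof. by rewrite dotmDl dotmNl. Qed.

Lemma dotmDr A B C : dotm A (B + C) = dotm A B + dotm A C.
Proof. by rewrite dotmC dotmDl !(dotmC A). Qed.

Lemma dotmZr a A B : dotm A (a *: B) = a * dotm A B.
Proof. by rewrite dotmC dotmZl dotmC. Qed.

Lemma dotmBr A B C : dotm A (B - C) = dotm A B - dotm A C.
Proof. by rewrite dotmC dotmBl !(dotmC A). Qed.

Lemma dotmm_ge0 A : 0 <= dotm A A.
Proof.
by apply: sumr_ge0 => i _; apply: sumr_ge0 => j _; rewrite -expr2 sqr_ge0.
Qed.

Lemma dotm0 A : dotm A 0 = 0.
Proof. by rewrite -(scale0r 0) dotmZr mul0r. Qed.

Lemma sqr_enorm A : enorm A ^+ 2 = dotm A A.
Proof. by rewrite sqr_sqrtr// dotmm_ge0. Qed.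

Lemma enorm_ge0 A : 0 <= enorm A.
Proof. exact: sqrtr_ge0. Qed.

Lemma entry_le_enorm A i j : `|A i j| <= enorm A.
Proof.
rewrite -sqrtr_sqr ler_sqrt ?dotmm_ge0// /dotm (bigD1 i)//= (bigD1 j)//=.
rewrite expr2 -addrA lerDl addr_ge0//.
  by apply: sumr_ge0 => k _; rewrite -expr2 sqr_ge0.
by apply: sumr_ge0 => k _; apply: sumr_ge0 => l _; rewrite -expr2 sqr_ge0.
Qed.

Lemma entry_le_normr A i j : `|A i j| <= `|A|.
Proof.
by rewrite [leRHS]/Num.norm/= mx_normrE; exact: (le_bigmax _ _ (i, j)).
Qed.

Lemma normr_le_entries A a : 0 <= a -> (forall i j, `|A i j| <= a) -> `|A| <= a.
Proof.
by move=> a0 Aa; rewrite [leLHS]/Num.norm/= mx_normrE; apply: bigmax_le.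
Qed.

Lemma normr_le_enorm A : `|A| <= enorm A.
Proof.
by apply: normr_le_entries => [|i j]; rewrite ?enorm_ge0 ?entry_le_enorm.
Qed.

Lemma enorm_eq0 A : enorm A = 0 -> A = 0.
Proof.
move=> A0; apply/eqP.
by rewrite -normr_eq0 eq_le normr_ge0 andbT -A0 normr_le_enorm.
Qed.

Lemma cauchy_schwarz A B : dotm A B <= enorm A * enorm B.
Proof.
have [/enorm_eq0->|A0] := eqVneq (enorm A) 0.
  by rewrite dotmC dotm0 mulr_ge0 ?enorm_ge0.
have [/enorm_eq0->|B0] := eqVneq (enorm B) 0.
  by rewrite dotm0 mulr_ge0 ?enorm_ge0.
have A1 : 0 < enorm A by rewrite lt0r A0 enorm_ge0.
have B1 : 0 < enorm B by rewrite lt0r B0 enorm_ge0.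
(* This square equals [2 * a * b * (a * b - x)] in the notation introduced below. *)
have := dotmm_ge0 (enorm B *: A - enorm A *: B).
rewrite dotmBr !dotmBl !dotmZr !dotmZl -!sqr_enorm (dotmC B A).
set a := enorm A in A1 *; set b := enorm B in B1 *; set x := dotm A B => h.
have : 0 <= (a * b) * (a * b - x) by nra.
by rewrite pmulr_rge0 ?subr_ge0// mulr_gt0.
Qed.

Lemma ler_enormD A B : enorm (A + B) <= enorm A + enorm B.
Proof.
rewrite -(@ler_pXn2r _ 2)// ?nnegrE ?addr_ge0 ?enorm_ge0//.
rewrite sqr_enorm dotmDr !dotmDl sqrrD !sqr_enorm (dotmC B A).
by have := cauchy_schwarz A B; lra.
Qed.

Lemma enormZ a A : enorm (a *: A) = `|a| * enorm A.
Proof.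
by rewrite /enorm dotmZl dotmZr mulrA -expr2 sqrtrM ?sqr_ge0// sqrtr_sqr.
Qed.

Lemma enormN A : enorm (- A) = enorm A.
Proof. by rewrite -scaleN1r enormZ normrN1 mul1r. Qed.

Lemma enorm0 : enorm (0 : 'M[R]_(m, n)) = 0.
Proof. by rewrite /enorm dotm0 sqrtr0. Qed.

Lemma enorm_le_normr A : enorm A <= (m * n)%:R * `|A|.
Proof.
rewrite -(@ler_pXn2r _ 2)// ?nnegrE ?mulr_ge0 ?enorm_ge0//.
rewrite sqr_enorm exprMn.
have: dotm A A <= \sum_(i < m) \sum_(j < n) `|A| ^+ 2.
  apply: ler_sum => i _; apply: ler_sum => j _.
  by rewrite -expr2 -real_normK ?num_real// lerXn2r ?nnegrE// entry_le_normr.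
move=> /le_trans; apply.
rewrite !sumr_const !card_ord -mulrnA -[leLHS]mulr_natl.
rewrite ler_wpM2r ?sqr_ge0// -natrX ler_nat (mulnC n) expnS expn1.
by case: (m * n)%N => // k; rewrite leq_pmulr.
Qed.

Lemma enorm_distC A B : enorm (A - B) = enorm (B - A).
Proof. by rewrite -enormN opprB. Qed.

Lemma ler_enorm_distD C A B : enorm (A - B) <= enorm (A - C) + enorm (C - B).
Proof. by apply: le_trans (ler_enormD _ _); rewrite addrA subrK. Qed.

Lemma cvg_dotm (X : Type) (F : set_system X) (FF : Filter F)
    (f g : X -> 'M[R]_(m, n)) A B :
  f @ F --> A -> g @ F --> B -> dotm (f x) (g x) @[x --> F] --> dotm A B.
Proof.
move=> fA gB.
apply: (cvg_big _ FF) => [|i _]; first exact: add_continuous.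
apply: (cvg_big _ FF) => [|j _]; first exact: add_continuous.
apply: cvgM.
  exact: (cvg_comp _ _ fA (@coord_continuous R m n i j A)).
exact: (cvg_comp _ _ gB (@coord_continuous R m n i j B)).
Qed.

Lemma dotm_continuous A : continuous (dotm A).
Proof.
move=> B; have FB : Filter (nbhs B) by exact: nbhs_filter.
exact: (cvg_dotm FB (cvg_cst A) cvg_id).
Qed.

Lemma sqr_dist_continuous A : continuous (fun B => dotm (A - B) (A - B)).
Proof.
move=> B; have FB : Filter (nbhs B) by exact: nbhs_filter.
have AB : (fun C : 'M[R]_(m, n) => A - C) @ nbhs B --> A - B :=
  cvgB (cvg_cst A) cvg_id.
exact: (cvg_dotm FB (AB FB FB) (AB FB FB)).
Qed.

End euclidean_norm.

Lemma normr_mulmx {R : realType} {m n p : nat} (A : 'M[R]_(m, n))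
  (B : 'M[R]_(n, p)) : `|A *m B| <= n%:R * (`|A| * `|B|).
Proof.
apply: normr_le_entries => [|i j]; first by rewrite !mulr_ge0.
rewrite mxE (le_trans (ler_norm_sum _ _ _))//.
rewrite -[n in n%:R]card_ord mulr_natl -sumr_const ler_sum// => k _.
by rewrite normrM ler_pM// entry_le_normr.
Qed.

(** * Young integral *)

Section young_sums.
Context {R : realType} {d e : nat}.
Implicit Types (f : R -> 'M[R]_(e, d)) (w : R -> 'cV[R]_d) (s : seq R).

(** The left end [a] is a parameter so that sums split at any node and induction on the partition is
    possible. *)
Fixpoint rsum f w (a : R) s : 'cV[R]_e :=
  if s is t :: s' then f a *m (w t - w a) + rsum f w t s' else 0.

Lemma riemann_sumE f w T s : riemann_sum f w T s = rsum f w 0 s.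
Proof.
rewrite /riemann_sum; move: (0 : R) => a; elim: s a => [|t s IH] a /=.
  by rewrite big_nil.
by rewrite big_nat_recl//=; congr (_ + _); rewrite -IH.
Qed.

Lemma rsum_cat f w a s1 s2 :
  rsum f w a (s1 ++ s2) = rsum f w a s1 + rsum f w (last a s1) s2.
Proof. by elim: s1 a => [a|t s1 IH a] /=; rewrite ?add0r// IH addrA. Qed.

Lemma rsum_lin f g w (p q : R) a s :
  rsum (fun t => p *: f t + q *: g t) w a s =
  p *: rsum f w a s + q *: rsum g w a s.
Proof.
elim: s a => [|t s IH] a /=; first by rewrite !scaler0 addr0.
by rewrite IH mulmxDl -!scalemxAl !scalerDr addrACA.
Qed.

(** As a [path] condition, the mesh bound splits along concatenations just as [rsum] does. *)
Lemma mesh_path T (delta : R) s : 0 < delta ->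
  path (fun x y => y - x < delta) 0 s <-> mesh T s < delta.
Proof.
move=> d0; rewrite /mesh; split=> [/(pathP T) h|h].
  by apply: bigmax_lt => // k _; exact: h.
apply/(pathP T) => i si.
by apply: le_lt_trans h; exact: (le_bigmax _ _ (Ordinal si)).
Qed.

(** Locates the step of the partition that straddles [c]; the sewing estimate takes the midpoint for
    [c]. *)
Lemma path_split (a c : R) s : a <= c -> c < last a s ->
  exists s1 x s2, [/\ s = s1 ++ x :: s2, last a s1 <= c & c < x].
Proof.
elim: s a => [|t s IH] a /= ac cl; first by move: ac; rewrite leNgt cl.
have [ct|tc] := ltP c t; first by exists [::], t, s.
have [s1 [x [s2 [-> h1 h2]]]] := IH _ tc cl.
by exists (t :: s1), x, s2.
Qed.

Lemma path_lt_last_ge (a : R) s : path <%R a s -> a <= last a s.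
Proof. by move=> p; apply: (@itv_partition_le _ _ _ _ s); split. Qed.

Lemma mem_path_lt_last (a x : R) s : path <%R a s -> x \in s -> x <= last a s.
Proof.
by move=> + /splitPr h; case: h => s1 s2; rewrite cat_path last_cat /=
  => /and3P[_ _ /path_lt_last_ge].
Qed.

Lemma fine_path (h a : R) n : 0 < h ->
  exists s, [/\ path <%R a s, path (fun x y => y - x <= h) a s
               & last a s = a + h *+ n].
Proof.
move=> h0; elim: n a => [|n IH] a; first by exists [::]; rewrite addr0.
have [s [s1 s2 s3]] := IH (a + h); exists (a + h :: s); split=> /=.
- by rewrite s1 ltrDl h0.
- by rewrite s2 addrAC subrr add0r lexx.
- by rewrite s3 mulrS addrA.
Qed.

Lemma fine_partition (T delta : R) : 0 <= T -> 0 < delta ->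
  exists2 s, itv_partition 0 T s & path (fun x y => y - x < delta) 0 s.
Proof.
rewrite le_eqVlt => /predU1P[<- _|T0 d0]; first by exists [::].
pose n := (Num.truncn (T / delta)).+1.
have n0 : 0 < n%:R :> R by rewrite ltr0n.
have hd : T / n%:R < delta.
  by rewrite ltr_pdivrMr// mulrC -ltr_pdivrMr// truncnS_gt.
have [s [s1 s2 s3]] := fine_path 0 n (divr_gt0 T0 n0).
exists s.
  by split=> //; rewrite s3 add0r -[eqbLHS]mulr_natr divfK// gt_eqF.
by apply: sub_path s2 => x y /le_lt_trans; exact.
Qed.

Lemma common_refinement (a b : R) s1 s2 :
  itv_partition a b s1 -> itv_partition a b s2 -> a < b ->
  exists s, [/\ itv_partition a b s, {subset s1 <= s} & {subset s2 <= s}].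
Proof.
move=> [p1 /eqP l1] [p2 /eqP l2] ab.
pose s := sort <=%R (undup (s1 ++ s2)).
have ms x : (x \in s) = (x \in s1) || (x \in s2).
  by rewrite mem_sort mem_undup mem_cat.
have as_ x : x \in s -> a < x.
  by rewrite ms => /orP[]; [move: p1|move: p2] => /lt_path_min/allP; exact.
have sb x : x \in s -> x <= b.
  rewrite ms => /orP[] xs; first by rewrite -l1; exact: mem_path_lt_last.
  by rewrite -l2; exact: mem_path_lt_last.
have p : path <%R a s.
  rewrite path_sortedE; last exact: lt_trans.
  by rewrite sort_lt_sorted undup_uniq andbT; apply/allP.
(* Since [a < b], the partition [s1] is not empty, so its last point [b] is one of its members. *)
have bs : b \in s.
  rewrite ms -l1; apply/orP; left.
  by move: ab; rewrite -l1; case: (s1) => [|x s']; rewrite /= ?ltxx// mem_last.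
exists s; split=> [|x xs|x xs]; rewrite ?ms ?xs ?orbT//.
split=> //; rewrite eq_le mem_path_lt_last// andbT.
have := mem_last a s; rewrite inE => /predU1P[->|/sb//]; exact: ltW.
Qed.

End young_sums.

(** * Sewing estimate for Riemann sums *)

Section young_estimate.
Context {R : realType} {d e : nat}.
Variables (f : R -> 'M[R]_(e, d)) (w : R -> 'cV[R]_d) (T alpha beta L W : R).
Hypotheses (alpha0 : 0 < alpha) (beta0 : 0 < beta) (ab1 : 1 < alpha + beta).
Hypotheses (L0 : 0 <= L) (W0 : 0 <= W).
Hypothesis f_hoelder : forall s t : R, 0 <= s -> s <= t -> t <= T ->
  `|f t - f s| <= L * (t - s) `^ alpha.
Hypothesis w_hoelder : forall s t : R, 0 <= s -> s <= t -> t <= T ->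
  `|w t - w s| <= W * (t - s) `^ beta.
Implicit Types s : seq R.

Let M := d%:R * (L * W).

(** Factor lost when an interval is replaced by its two halves; it is below 1 exactly because
    [1 < alpha + beta]. The constant [young_const] sums the geometric series of the defects over the
    dyadic scales, and its factor [d] comes from the sup norm of a matrix product. *)
Definition young_ratio : R := 2 * 2^-1 `^ (alpha + beta).
Definition young_const : R := 2 * (d%:R * (L * W)) / (1 - young_ratio).

Lemma young_ratio_lt1 : young_ratio < 1.
Proof.
rewrite /young_ratio -ltr_pdivlMl// mulr1 -[ltRHS]powRr1//.
have h : 2^-1 `^ (alpha + beta - 1) < 1.
  have h0 : 0 < alpha + beta - 1 by rewrite subr_gt0.
  have := @gt0_ltr_powR R _ h0 2^-1 1.
  rewrite powR1; apply; rewrite ?nnegrE ?invr_ge0//.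
  by rewrite invf_lt1// ltr1n.
rewrite -[in ltLHS](subrK 1 (alpha + beta)) powRD; last first.
  by rewrite invr_eq0 pnatr_eq0 implybT.
by rewrite gtr_pMl// powR_gt0.
Qed.

Let M0 : 0 <= M.
Proof. by rewrite !mulr_ge0. Qed.

Lemma young_const_ge0 : 0 <= young_const.
Proof. by rewrite divr_ge0// ?subr_ge0 ?(ltW young_ratio_lt1)// ?mulr_ge0. Qed.

Let defect (s t u v x : R) :
  0 <= s -> s <= t -> t <= T -> 0 <= u -> u <= v -> v <= T ->
  t - s <= x -> v - u <= x ->
  `|(f t - f s) *m (w v - w u)| <= M * x `^ (alpha + beta).
Proof.
move=> s0 st tT u0 uv vT tsx vux.
rewrite (le_trans (normr_mulmx _ _))// /M -mulrA ler_wpM2l//.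
have x0 : 0 <= x by apply: le_trans tsx; rewrite subr_ge0.
rewrite powRD; last by apply/implyP; rewrite gt_eqF// addr_gt0.

rewrite [leRHS]mulrACA ler_pM//.
- apply: (le_trans (f_hoelder s0 st tT)).
  by rewrite ler_wpM2l// ge0_ler_powR ?nnegrE ?subr_ge0// ltW.
- apply: (le_trans (w_hoelder u0 uv vT)).
  by rewrite ler_wpM2l// ge0_ler_powR ?nnegrE ?subr_ge0// ltW.
Qed.

(* Splitting at the midpoint leaves two partitions of at most half the length
   and two defects, whence the fixed point equation
   [young_const * young_ratio + 2 M = young_const]. *)
Lemma rsum_sewing (a : R) s : 0 <= a -> path <%R a s -> last a s <= T ->
  `|rsum f w a s - f a *m (w (last a s) - w a)| <=
  young_const * (last a s - a) `^ (alpha + beta).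
Proof.
have [n] := ubnP (size s); elim: n a s => [//|n IH] a s.
rewrite ltnS => sn a0 p lT.
have [sa|s0] := eqVneq (size s) 0%N.
  rewrite (size0nil sa) /= !subrr mulmx0 subrr normr0 mulr_ge0 ?powR_ge0//.
  exact: young_const_ge0.
set b : R := last a s in lT *.
have ab : a < b.
  by apply: (@itv_partition_size_neq0 _ _ _ _ s); [rewrite lt0n|split].
pose c : R := (a + b) / 2.
have cE : c = (a + b) / 2 by [].
have [ac cb] : a <= c /\ c < b by split; rewrite /c; lra.
have [s1 [x [s2 [sE h1 h2]]]] := path_split ac cb.
have := p; rewrite sE cat_path /= => /and3P[p1 p01 p2].
have l2 : last x s2 = b by rewrite /b sE last_cat.
set y : R := last a s1 in h1 p01 *.
have ay : a <= y := path_lt_last_ge p1.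
have xb : x <= b by rewrite -l2; exact: path_lt_last_ge.
have sz : size s = (size s1 + (size s2).+1)%N by rewrite sE size_cat.
have S1 : (size s1 < n)%N.
  by apply: leq_trans sn; rewrite sz addnS ltnS leq_addr.
have S2 : (size s2 < n)%N.
  by apply: leq_trans sn; rewrite sz addnS ltnS leq_addl.
have I1 := IH a s1 S1 a0 p1.
have I2 := IH x s2 S2.
rewrite -/y in I1; rewrite l2 in I2.
have yT : y <= T by lra.
have x0 : 0 <= x by lra.
move: I1 I2 => /(_ yT) I1 /(_ x0 p2 lT) I2.
set D := b - a.
have half (z : R) : 0 <= z -> z <= 2^-1 * D ->
    z `^ (alpha + beta) <= 2^-1 `^ (alpha + beta) * D `^ (alpha + beta).
  move=> z0 zD; rewrite -powRM ?invr_ge0// ?subr_ge0 ?(ltW ab)//.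
  have D0 : 0 <= D by rewrite subr_ge0 ltW.
  by rewrite ge0_ler_powR ?nnegrE ?mulr_ge0 ?invr_ge0// ltW// addr_gt0.
have D1 : `|(f y - f a) *m (w x - w y)| <= M * D `^ (alpha + beta).
  by apply: defect; rewrite /D; lra.
have D2 : `|(f x - f a) *m (w b - w x)| <= M * D `^ (alpha + beta).
  by apply: defect; rewrite /D; lra.
(* The step from [y] to [x] straddles the midpoint and belongs to neither half. Its term, and the
   change of left value from [f a] to [f x] on the rest, produce the two defects. *)
have -> : rsum f w a (s1 ++ x :: s2) - f a *m (w b - w a) =
    (rsum f w a s1 - f a *m (w y - w a)) + (rsum f w x s2 - f x *m (w b - w x))
    + ((f y - f a) *m (w x - w y) + (f x - f a) *m (w b - w x)).
  rewrite rsum_cat/= -/y !mulmxBl !mulmxBr.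
  by apply/matrixP => i j; rewrite !mxE; ring.
apply: (le_trans (ler_normD _ _)).
apply: (le_trans (lerD (ler_normD _ _) (ler_normD _ _))).
apply: (le_trans (lerD (lerD I1 I2) (lerD D1 D2))).
have H1 : (y - a) `^ (alpha + beta) <=
    2^-1 `^ (alpha + beta) * D `^ (alpha + beta).
  by apply: half; rewrite /D; lra.
have H2 : (b - x) `^ (alpha + beta) <=
    2^-1 `^ (alpha + beta) * D `^ (alpha + beta).
  by apply: half; rewrite /D; lra.
have kE : young_const = young_const * young_ratio + 2 * M.
  rewrite /young_const -/M; field.
  by rewrite subr_eq0 eq_sym lt_eqF// young_ratio_lt1.
have K0 := young_const_ge0.
rewrite [in leRHS]kE /young_ratio.
have := ler_wpM2l K0 H1; have := ler_wpM2l K0 H2; nra.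
Qed.

(** Sewing is applied on each step of [s]. Of the power [alpha + beta] of its length, one factor is
    kept and adds up to the total length; the rest is bounded through [delta]. *)
Lemma rsum_refinement (delta a : R) s s' : 0 <= a -> last a s <= T ->
  path <%R a s -> path <%R a s' -> last a s' = last a s ->
  {subset s <= s'} -> path (fun x y => y - x <= delta) a s ->
  `|rsum f w a s' - rsum f w a s| <=
  young_const * delta `^ (alpha + beta - 1) * (last a s - a).
Proof.
elim: s a s' => [|t s IH] a s' a0 lT p p' /= ll ss.
  have -> : s' = [::].
    by apply: (@itv_partitionxx _ _ a); split=> //; rewrite ll.
  by rewrite !subrr normr0 mulr0.
move=> /andP[td pd]; move: p => /=/andP[at_ p].
have ts' : t \in s' by apply: ss; rewrite mem_head.
move: p' ll ss; case/splitPr: ts' => s1 s2.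
rewrite cat_path last_cat /= => /and3P[p1 yt p2] ll ss.
rewrite -cat1s catA cats1 rsum_cat last_rcons.
have pr : path <%R a (rcons s1 t) by rewrite rcons_path p1.
have ss2 : {subset s <= s2}.
  move=> x xs; have tx : t < x by move/lt_path_min/allP : p; exact.
  have : x \in s1 ++ t :: s2 by apply: ss; rewrite inE xs orbT.
  rewrite mem_cat inE => /or3P[xs1|/eqP xt|//].
    have := mem_path_lt_last p1 xs1; move: yt tx; lra.
  by move: tx; rewrite xt ltxx.
have ts : t <= last t s := path_lt_last_ge p.
have t0 : 0 <= t by lra.
have I2 := IH t s2 t0 lT p p2 ll ss2 pd.
have := @rsum_sewing a (rcons s1 t) a0 pr; rewrite last_rcons => /(_ _) I1.
have {}I1 := I1 (le_trans ts lT).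
have -> : rsum f w a (rcons s1 t) + rsum f w t s2 -
    (f a *m (w t - w a) + rsum f w t s) =
    (rsum f w a (rcons s1 t) - f a *m (w t - w a)) +
    (rsum f w t s2 - rsum f w t s).
  by rewrite opprD addrACA.
apply: (le_trans (ler_normD _ _)); apply: (le_trans (lerD I1 I2)).
have -> : last t s - a = (t - a) + (last t s - t) by ring.
rewrite [leRHS]mulrDr lerD2r -mulrA ler_wpM2l ?young_const_ge0//.
have ta0 : 0 <= t - a by rewrite subr_ge0 ltW.
rewrite -mulr_powRB1// ?addr_gt0// [leLHS]mulrC ler_wpM2r//.
by rewrite ge0_ler_powR ?nnegrE//; [rewrite subr_ge0 ltW|exact: le_trans td].
Qed.

(** The factor 2 accounts for comparing two partitions with a common refinement. The integrand
    enters only through [L]. *)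
Definition young_modulus (delta : R) : R :=
  2 * (young_const * delta `^ (alpha + beta - 1) * T).

Lemma rsum_cauchy (delta : R) s s' : 0 < T ->
  itv_partition 0 T s -> itv_partition 0 T s' ->
  path (fun x y => y - x <= delta) 0 s ->
  path (fun x y => y - x <= delta) 0 s' ->
  `|rsum f w 0 s - rsum f w 0 s'| <= young_modulus delta.
Proof.
move=> T0 ps ps' ds ds'.
have [s2 [p2 ss ss']] := common_refinement ps ps' T0.
case: ps ps' p2 => [p /eqP l] [p' /eqP l'] [p2 /eqP l2].
have A := @rsum_refinement delta 0 s s2 (lexx _) _ p p2 _ ss ds.
have B := @rsum_refinement delta 0 s' s2 (lexx _) _ p' p2 _ ss' ds'.
rewrite l l2 subr0 in A; rewrite l' l2 subr0 in B.
rewrite -[X in `|X|](subrKA (rsum f w 0 s2)) (le_trans (ler_normD _ _))//.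
rewrite /young_modulus mulr_natl mulr2n lerD ?B//.
by rewrite distrC A.
Qed.

Lemma young_modulus_small (eps : R) : 0 < eps ->
  exists2 delta, 0 < delta & young_modulus delta <= eps.
Proof.
move=> e0.
(* The [+ 1] keeps [C] positive; [delta] is then chosen so that its power of exponent
   [alpha + beta - 1] is [eps / C]. *)
pose C := 2 * (young_const * `|T|) + 1.
have C0 : 0 < C by rewrite ltr_wpDl// mulr_ge0// mulr_ge0// young_const_ge0.
have th : 0 < alpha + beta - 1 by rewrite subr_gt0.
exists ((eps / C) `^ (alpha + beta - 1)^-1).
  by rewrite powR_gt0// divr_gt0.
have eC0 : 0 <= eps / C by rewrite divr_ge0// ltW.
rewrite /young_modulus -powRrM mulVf ?gt_eqF// powRr1//.
have k0 := young_const_ge0.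
rewrite -[leRHS](divfK (lt0r_neq0 C0)).
have : 2 * (young_const * (eps / C) * T) <=
    eps / C * (2 * (young_const * `|T|)).
  rewrite (_ : _ * _ = (eps / C) * (2 * (young_const * T))); last by ring.
  by rewrite ler_wpM2l// ler_wpM2l// ler_wpM2l// ler_norm.
by move=> /le_trans; apply; rewrite ler_wpM2l// /C lerDl.
Qed.

End young_estimate.

Lemma convex_setP {R : realType} (V : lmodType R) (A : set V) :
  convex_set (A : set (convex_lmodType V)) <->
  forall x y (l : R), 0 <= l -> l <= 1 -> A x -> A y ->
    A (l *: x + (1 - l) *: y).
Proof.
split=> [cA x y l l0 l1 Ax Ay|cA x y l].
  by have := cA x y (Itv01 l0 l1); rewrite !inE => /(_ Ax Ay).
rewrite !inE => Ax Ay; exact: cA.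
Qed.

Lemma hoelder_seminormP {R : realType} {X : Type} (dist : X -> X -> \bar R)
    (alpha T r : R) (F : R -> X) :
  (hoelder_seminorm dist alpha T F <= r%:E)%E <->
  forall s t, 0 <= s -> s < t -> t <= T ->
    (dist (F s) (F t) <= (r * (t - s) `^ alpha)%:E)%E.
Proof.
split=> [h s t s0 st tT|h].
  have ts : 0 < (t - s) `^ alpha by rewrite powR_gt0 ?subr_gt0.
  rewrite EFinM -lee_pdivrMr//; apply: le_trans h.
  by apply: ereal_sup_ubound; exists (s, t).
apply: ge_ereal_sup => _ [[s t] [s0 st tT] <-] /=.
by rewrite lee_pdivrMr ?powR_gt0 ?subr_gt0// -EFinM; exact: h.
Qed.

(** * Existence, approximation and linearity of the Young integral *)

Section young_integral.
Context {R : realType} {d e : nat}.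
Variables (T alpha beta W : R) (w : R -> 'cV[R]_d).
Hypotheses (T0 : 0 < T) (alpha0 : 0 < alpha) (beta0 : 0 < beta).
Hypotheses (ab1 : 1 < alpha + beta) (W0 : 0 <= W).
Hypothesis w_hoelder : forall s t : R, 0 <= s -> s <= t -> t <= T ->
  `|w t - w s| <= W * (t - s) `^ beta.
Implicit Types (f : R -> 'M[R]_(e, d)) (L : R) (I : 'cV[R]_e).

Definition hoelder_on L f := forall s t : R, 0 <= s -> s <= t -> t <= T ->
  `|f t - f s| <= L * (t - s) `^ alpha.

Lemma is_young_integralP f I : is_young_integral f w T I <->
  forall eps : R, 0 < eps -> exists2 delta : R, 0 < delta &
    forall s : seq R, itv_partition 0 T s ->
      path (fun x y => y - x < delta) 0 s ->
      `|I - rsum f w 0 s| < eps.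
Proof.
split=> [/cvgrPdist_lt h eps e0|h].
  have [delta d0 hd] := h eps e0; exists delta => // s p ds.
  by rewrite -(riemann_sumE _ _ T); apply: hd => //; exact/(mesh_path T _ d0).
apply/cvgrPdist_lt => eps e0; have [delta d0 hd] := h eps e0.
exists delta => // s p ds /=.
by rewrite riemann_sumE; apply: hd => //; exact/(mesh_path T _ d0).
Qed.

Lemma young_integral_exists L f : 0 <= L -> hoelder_on L f ->
  exists I, is_young_integral f w T I.
Proof.
move=> L0 fL.
have PF : ProperFilter (mesh_to0 T).
  apply: Build_ProperFilter_ex => P [delta d0 hP].
  have [s p ds] := fine_partition (ltW T0) d0.
  by exists s; apply: hP => //; exact/(mesh_path T _ d0).
suff /cauchy_cvg/cvg_ex[I hI] : cauchy (riemann_sum f w T @ mesh_to0 T).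
  by exists I.
apply/cauchy_exP => eps e0.
have e2 : 0 < eps / 2 by rewrite divr_gt0.
have [delta d0 hd] := young_modulus_small (d := d) T ab1 L0 W0 e2.
have [s p ds] := fine_partition (ltW T0) d0.
exists (rsum f w 0 s).
exists delta => // s' p' /(mesh_path T _ d0) ds' /=.
rewrite -ball_normE /= riemann_sumE.
apply: (@le_lt_trans _ _ (eps / 2)); last by lra.
apply: le_trans hd; apply: rsum_cauchy => //.
  by apply: sub_path ds => x y; exact: ltW.
by apply: sub_path ds' => x y; exact: ltW.
Qed.

(** The limit of [rsum_cauchy] along ever finer partitions. The bound is the same for all [f] with
    constant [L], which is what exchanging the integral with a pointwise limit requires. *)
Lemma young_integral_approx L f I (delta : R) s : 0 <= L -> hoelder_on L f ->
  is_young_integral f w T I -> 0 < delta ->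
  itv_partition 0 T s -> path (fun x y => y - x <= delta) 0 s ->
  `|I - rsum f w 0 s| <= young_modulus (d := d) T alpha beta L W delta.
Proof.
move=> L0 fL /is_young_integralP hI d0 p ds; apply/ler_addgt0Pr => eps e0.
have [delta' d'0 hd] := hI eps e0.
have m0 : 0 < Num.min delta delta' by rewrite lt_min d0.
have [s' p' ds'] := fine_partition (ltW T0) m0.
have A : `|I - rsum f w 0 s'| < eps.
  apply: hd => //; apply: sub_path ds' => x y /lt_le_trans; apply.
  by rewrite ge_min lexx orbT.
have B : `|rsum f w 0 s' - rsum f w 0 s| <=
    young_modulus (d := d) T alpha beta L W delta.
  apply: rsum_cauchy => //; apply: sub_path ds' => x y /ltW/le_trans; apply.
  by rewrite ge_min lexx.
rewrite -(subrKA (rsum f w 0 s')) addrC.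
by apply: (le_trans (ler_normD _ _)); rewrite lerD// ltW.
Qed.

Lemma young_integral_bound L f I : 0 <= L -> hoelder_on L f ->
  is_young_integral f w T I ->
  `|I| <= d%:R * (`|f 0| * `|w T - w 0|)
          + young_const (d := d) alpha beta L W * T `^ (alpha + beta).
Proof.
move=> L0 fL /is_young_integralP hI; apply/ler_addgt0Pr => eps e0.
have [delta d0 hd] := hI eps e0.
have [s p ds] := fine_partition (ltW T0) d0.
have A := hd s p ds; case: p => [p /eqP l].
have B := rsum_sewing alpha0 beta0 ab1 L0 W0 fL w_hoelder (lexx 0) p.
rewrite l subr0 in B; have {}B := B (lexx T).
have -> : I = f 0 *m (w T - w 0) + (rsum f w 0 s - f 0 *m (w T - w 0))
   + (I - rsum f w 0 s) by rewrite [X in X + _]addrC !subrK addrC subrK.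
apply: (le_trans (ler_normD _ _)); rewrite lerD ?(ltW A)//.
by apply: (le_trans (ler_normD _ _)); rewrite lerD// normr_mulmx.
Qed.

Lemma is_young_integral_lin f g I J (p q : R) :
  is_young_integral f w T I -> is_young_integral g w T J ->
  is_young_integral (fun t => p *: f t + q *: g t) w T (p *: I + q *: J).
Proof.
move=> hI hJ; rewrite /is_young_integral.
have -> : riemann_sum (fun t => p *: f t + q *: g t) w T =
    (fun s => p *: riemann_sum f w T s + q *: riemann_sum g w T s).
  by apply/funext => s; rewrite !riemann_sumE rsum_lin.
by apply: cvgD; apply: cvgZr.
Qed.

(** Allows a selection to be set to [0] off [[0, T]] in the compactness argument. *)
Lemma eq_rsum f g a s : 0 <= a -> path <%R a s -> last a s <= T ->
  (forall t, 0 <= t <= T -> f t = g t) -> rsum f w a s = rsum g w a s.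
Proof.
move=> + + + fg; elim: s a => //= t s IH a a0 /andP[at_ p] lT.
have ts := path_lt_last_ge p.
rewrite IH//; last by apply: le_trans (ltW at_).
by rewrite fg// a0/= (le_trans (ltW at_))// (le_trans ts).
Qed.

End young_integral.

Lemma lipschitz_mx_continuous {R : realType} {m n p q : nat} (k : R)
    (f : 'M[R]_(m, n) -> 'M[R]_(p, q)) : 0 <= k ->
  (forall A B, `|f A - f B| <= k * `|A - B|) -> continuous f.
Proof.
move=> k0 fk A; have FA : Filter (nbhs A) by exact: nbhs_filter.
apply/cvgrPdist_le => /= eps e0.
have k1 : 0 < k + 1 by rewrite ltr_wpDl.
have : nbhs A (ball A (eps / (k + 1))).
  by apply: nbhsx_ballx; rewrite divr_gt0.
rewrite -ball_normE; apply: (@filterS _ _ FA) => B /= AB.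
rewrite (le_trans (fk _ _))// -[leRHS](divfK (lt0r_neq0 k1)) mulrC.
by rewrite ler_pM ?(ltW AB)// lerDl.
Qed.

Lemma mulmxr_continuous {R : realType} {m n p : nat} (v : 'M[R]_(n, p)) :
  continuous (fun M : 'M[R]_(m, n) => M *m v).
Proof.
apply: (@lipschitz_mx_continuous _ _ _ _ _ (n%:R * `|v|)) => [|A B].
  by rewrite mulr_ge0.
by rewrite -mulmxBl (le_trans (normr_mulmx _ _))// -mulrA (mulrC `|v|).
Qed.

(** * The Aumann-Young integral *)

Section hoelder_functions.
Context {R : realType} {m n : nat}.
Variables (T alpha r : R).
Hypotheses (T0 : 0 < T) (alpha0 : 0 < alpha) (r0 : 0 <= r).
Implicit Types (f : R -> 'M[R]_(m, n)).

Lemma hoelder_edistmP f : (hoelder_seminorm edistm alpha T f <= r%:E)%E <->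
  forall s t : R, 0 <= s -> s < t -> t <= T ->
    enorm (f s - f t) <= r * (t - s) `^ alpha.
Proof. exact: hoelder_seminormP. Qed.

Lemma hoelder_edistm_on f : (hoelder_seminorm edistm alpha T f <= r%:E)%E ->
  hoelder_on T alpha r f.
Proof.
move=> /hoelder_edistmP h s t s0 + tT; rewrite le_eqVlt => /predU1P[->|st].
  by rewrite subrr normr0 mulr_ge0 ?powR_ge0.
by rewrite distrC (le_trans (normr_le_enorm _))// h.
Qed.

(** Nothing is known of [f] off [[0, T]]. Composing with the retraction [c] of the line onto
    [[0, T]] gives a continuous function on the whole line that agrees with [f] on the interval. *)
Lemma hoelder_measurable f : hoelder_on T alpha r f ->
  measurable_fun `[0, T] (f : R -> g_sigma_algebraType (@open 'M[R]_(m, n))).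
Proof.
move=> fr; pose c (t : R) := Num.min T (Num.max 0 t).
have cT t : 0 <= c t <= T by rewrite le_min ge_min lexx le_max lexx (ltW T0).
have ct t : 0 <= t <= T -> c t = t.
  by move=> /andP[t0 tT]; rewrite /c max_r// min_r.
have c_lip (s t : R) : s <= t -> 0 <= c t - c s <= t - s.
  by move=> st; rewrite /c; case: (leP 0 s) => ?; case: (leP 0 t) => ?;
    case: (leP T s) => ?; case: (leP T t) => ?; case: (leP T 0) => ?; lra.
have gr (s t : R) : `|f (c t) - f (c s)| <= r * `|t - s| `^ alpha.
  wlog st : s t / s <= t.
    move=> h; have [/h//|/ltW/h] := leP s t.
    by rewrite (distrC (f _)) (distrC s).
  have /andP[h1 h2] := c_lip _ _ st.
  have /andP[s0 _] := cT s; have /andP[_ tT] := cT t.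
  apply: (le_trans (fr _ _ s0 _ tT)); first by rewrite -subr_ge0.
  have st0 : 0 <= t - s by rewrite subr_ge0.
  by rewrite ler_wpM2l// (ger0_norm st0) ge0_ler_powR ?nnegrE// ltW.
have gc : continuous (f \o c).
  move=> t; apply/cvgrPdist_le => /= eps e0.
  pose delta := (eps / (r + 1)) `^ alpha^-1.
  have r1 : 0 < r + 1 by rewrite ltr_wpDl.
  have d0 : 0 < delta by rewrite powR_gt0// divr_gt0.
  have : nbhs t (ball t delta) by exact: nbhsx_ballx.
  apply: filterS => s; rewrite -ball_normE /= => ts.
  apply: (le_trans (gr _ _)).
  have : `|t - s| `^ alpha <= eps / (r + 1).
    have -> : eps / (r + 1) = delta `^ alpha.
      by rewrite -powRrM mulVf ?gt_eqF// powRr1// divr_ge0// ltW.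
    by rewrite ge0_ler_powR ?nnegrE// ?ltW.
  move=> h; rewrite -[leRHS](divfK (lt0r_neq0 r1)) mulrC ler_pM ?powR_ge0//.
  by rewrite lerDl.
apply: measurability; first by [].
move=> _ [U oU <-].
have -> : `[0, T] `&` f @^-1` U = `[0, T] `&` (f \o c) @^-1` U.
  apply/seteqP; split=> t /= [tT]; rewrite !in_itv /= in tT *;
    by rewrite (ct _ tT).
apply: measurableI => //; apply: open_measurable.
by move/continuousP: gc; exact.
Qed.

End hoelder_functions.

Section aumann_young_integral.
Context {R : realType} {d e : nat}.
Variables (T alpha beta W r : R) (w : R -> 'cV[R]_d).
Variable F : R -> set 'M[R]_(e, d).
Hypotheses (T0 : 0 < T) (alpha0 : 0 < alpha) (beta0 : 0 < beta).
Hypotheses (ab1 : 1 < alpha + beta) (W0 : 0 <= W) (r0 : 0 <= r).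
Hypothesis w_hoelder : forall s t : R, 0 <= s -> s <= t -> t <= T ->
  `|w t - w s| <= W * (t - s) `^ beta.
Hypothesis F_Pck : forall t, t \in `[0, T] -> Pck (F t).

Let S := hoelder_selections T alpha r F.
Let J := aumann_young T alpha r F w.

Lemma hoelder_selectionsP f : S f <->
  (forall t, 0 <= t <= T -> F t (f t)) /\
  (forall s t : R, 0 <= s -> s < t -> t <= T ->
    enorm (f s - f t) <= r * (t - s) `^ alpha).
Proof.
have frP := hoelder_edistmP T alpha r f.
split=> [[_ fF /frP fr]|[fF /frP fr]].
  by split=> // t tT; apply: fF; rewrite in_itv.
split=> [|t|//]; last by rewrite in_itv /=; exact: fF.
apply: (hoelder_measurable T0 alpha0 r0).
exact: (hoelder_edistm_on r0).
Qed.

Lemma aumann_young_bounded : bounded_set J.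
Proof.
have z0 : 0 \in `[0, T] by rewrite in_itv /= lexx ltW.
have [_ _ /compact_bounded[M [_ hM]]] := F_Pck z0.
(* The initial value of a selection lies in the compact set [F 0]; boundedness provides the bound
   for numbers strictly above [M], hence [M + 1]. *)
pose B := d%:R * ((M + 1) * `|w T - w 0|)
          + young_const (d := d) alpha beta r W * T `^ (alpha + beta).
exists B; split; first by rewrite num_real.
move=> x Bx I [f [_ fF fr] fI].
apply: le_trans (ltW Bx).
apply: (le_trans (young_integral_bound T0 alpha0 beta0 ab1 W0 w_hoelder r0
  (hoelder_edistm_on r0 fr) fI)).
rewrite lerD2r ler_wpM2l// ler_wpM2r//; apply: hM; first by rewrite ltrDl.
exact: fF.
Qed.

Lemma aumann_young_convex :
  convex_set (J : set (convex_lmodType 'cV[R]_e)).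
Proof.
apply/convex_setP => I I' l l0 l1 [f Sf fI] [g Sg gI].
exists (fun t => l *: f t + (1 - l) *: g t); last exact: is_young_integral_lin.
have [fF fr] := (hoelder_selectionsP f).1 Sf.
have [gF gr] := (hoelder_selectionsP g).1 Sg.
apply/hoelder_selectionsP; split=> [t tT|s t s0 st tT].
  have [_ /convex_setP cF _] := F_Pck (tT : t \in `[0, T]).
  by apply: cF => //; [exact: fF|exact: gF].
rewrite opprD addrACA -!scalerBr (le_trans (ler_enormD _ _))// !enormZ.
rewrite !ger0_norm ?subr_ge0//.
have := ler_wpM2l l0 (fr s t s0 st tT).
have l2 : 0 <= 1 - l by rewrite subr_ge0.
by have := ler_wpM2l l2 (gr s t s0 st tT); lra.
Qed.

Lemma aumann_young_nonempty : S !=set0 -> J !=set0.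
Proof.
move=> [f Sf]; have [_ _ fr] := Sf.
have [I fI] := young_integral_exists T0 alpha0 beta0 ab1 W0 w_hoelder r0
  (hoelder_edistm_on r0 fr).
by exists I, f.
Qed.

(** Tychonoff's theorem needs a compact factor at every real [t], whereas [F] is controlled on
    [[0, T]] only. *)
Let K t : set 'M[R]_(e, d) := if 0 <= t <= T then F t else [set 0].

Let compact_K t : compact (K t).
Proof.
rewrite /K; case: ifPn => [tT|_]; last exact: compact_set1.
by have [] := F_Pck (tT : t \in `[0, T]).
Qed.

Import ArrowAsProduct.

(** Continuity is for the product topology: the sum involves [f] through finitely many
    evaluations. *)
Let rsum_continuous a s :
  continuous (fun f : R -> 'M[R]_(e, d) => rsum f w a s).
Proof.
elim: s a => [|t s IH] a /= f; first exact: cst_continuous.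
have fa : continuous (fun f : R -> 'M[R]_(e, d) => f a).
  by move=> g; exact: (@proj_continuous R (fun=> 'M[R]_(e, d)) a g).
have fv := continuous_comp (fa f)
  (@mulmxr_continuous R e d 1 (w t - w a) (f a)).
by apply: (cvgD fv); exact: IH.
Qed.

(* By Tychonoff's theorem, selections whose integrals approach [I] accumulate
   pointwise at some [h]; as [rsum] approximates the integral uniformly on
   [S], the integral of [h] is [I]. *)
Lemma aumann_young_closed : closed J.
Proof.
move=> I clI.
(* These sets generate a filter, which replaces a sequence of selections: the product topology over
   the real line is not metrizable. Selections are set to [0] off [[0, T]] to lie in the product of
   the [K t]. *)
pose B (eps : R) := [set g : R -> 'M[R]_(e, d) | exists f I',
  [/\ S f, is_young_integral f w T I', `|I - I'| < eps
    & g = fun t => if 0 <= t <= T then f t else 0]].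
pose G := filter_from [set eps : R | 0 < eps] B.
have PG : ProperFilter G.
  apply: filter_from_proper => [|eps e0].
    apply: filter_from_filter; first by exists 1; exact: ltr01.
    move=> i j i0 j0; exists (Num.min i j).
      by rewrite /= lt_min; apply/andP.
    move=> g [f [I' [Sf fI' + gf]]]; rewrite lt_min => /andP[h1 h2].
    by split; exists f, I'.
  have [I' [[f Sf fI'] II']] := clI _ (nbhsx_ballx I _ e0).
  rewrite -ball_normE /= in II'.
  by exists (fun t => if 0 <= t <= T then f t else 0), f, I'.
have GK : G [set g | forall t, K t (g t)].
  exists 1 => //= _ [f [I' [/hoelder_selectionsP[fF _] _ _ ->]]] t.
  by rewrite /K; case: ifPn => // tT; exact: fF.
have [h [hK hcl]] := @tychonoff R (fun=> 'M[R]_(e, d)) K compact_K G PG GK.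
exists h.
  apply/hoelder_selectionsP; split=> [t tT|s t s0 st tT].
    by have := hK t; rewrite /K tT.
  apply/ler_addgt0Pr => eps e0.
  (* Neighbourhoods are sup norm balls; radius [eta] makes the Euclidean error at most [eps / 2] at
     each of the two times. *)
  pose C : R := (e * d)%:R + 1.
  have C0 : 0 < C by rewrite ltr_wpDl.
  pose eta := eps / 2 / C.
  have eta0 : 0 < eta by rewrite !divr_gt0.
  have near_h u : nbhs h [set g : R -> 'M[R]_(e, d) | ball (h u) eta (g u)].
    have := @proj_continuous R (fun=> 'M[R]_(e, d)) u h.
    by apply; exact: nbhsx_ballx.
  have small (M N : 'M[R]_(e, d)) : ball M eta N -> enorm (M - N) <= eps / 2.
    rewrite -ball_normE /= => MN; apply: (le_trans (enorm_le_normr _)).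
    rewrite -[leRHS](divfK (lt0r_neq0 C0)) mulrC ler_pM ?(ltW MN)//.
    by rewrite /C lerDl.
  have G1 : G (B 1) by exists 1 => /=.
  have [g [Bg [/small gs /small gt_]]] :=
    hcl _ _ G1 (filterI (near_h s) (near_h t)).
  have [f [I' [/hoelder_selectionsP[_ fr] _ _ gE]]] := Bg.
  have gfs : g s = f s by rewrite gE s0 (le_trans (ltW st)).
  have gft : g t = f t by rewrite gE tT (le_trans s0)// ltW.
  rewrite gfs in gs; rewrite gft enorm_distC in gt_.
  have := ler_enorm_distD (f s) (h s) (h t).
  have := ler_enorm_distD (f t) (f s) (h t).
  have := fr s t s0 st tT; lra.
apply/is_young_integralP => eps e0.
(* Three errors of [eps / 4]: from [I] to [I'], from [I'] to the sum of [f], and from there to the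
   sum of [h]. *)
have e4 : 0 < eps / 4 by rewrite divr_gt0.
have [delta d0 hd] := young_modulus_small (d := d) T ab1 r0 W0 e4.
exists delta => // s p ds.
have G1 : G (B (eps / 4)) by exists (eps / 4).
have near_h : nbhs h [set g : R -> 'M[R]_(e, d) |
    ball (rsum h w 0 s) (eps / 4) (rsum g w 0 s)].
  by apply: (@rsum_continuous 0 s h); exact: nbhsx_ballx.
have [g [[f [I' [Sf fI' II' gE]]]]] := hcl _ _ G1 near_h.
rewrite -ball_normE /= => hg.
have rE : rsum g w 0 s = rsum f w 0 s.
  case: (p) => p1 /eqP p2; apply: (@eq_rsum _ _ _ T) => //.
    by rewrite p2.
  by move=> t tT; rewrite gE tT.
have [_ _ /(hoelder_edistm_on r0) fr] := Sf.
have A := young_integral_approx T0 alpha0 beta0 ab1 W0 w_hoelder r0 fr fI' d0 p.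
have {}A : `|I' - rsum f w 0 s| <= eps / 4.
  by apply: (le_trans (A _)) => //; apply: sub_path ds => x y; exact: ltW.
rewrite rE distrC in hg.
have -> : I - rsum h w 0 s = (I - I') + (I' - rsum f w 0 s)
    + (rsum f w 0 s - rsum h w 0 s) by rewrite !subrKA.
have := ler_normD (I - I' + (I' - rsum f w 0 s)) (rsum f w 0 s - rsum h w 0 s).
have := ler_normD (I - I') (I' - rsum f w 0 s).
lra.
Qed.

End aumann_young_integral.

(** * Lebesgue measure on tuples *)

Section lebesgue_tuple_theory.
Context {R : realType}.
Local Notation Rm := (measurableTypeR R).

(** As [x] varies, this runs along the line through [t] parallel to the axis [j]. *)
Definition tuple_upd m (t : m.-tuple R) (j : 'I_m) (x : R) : m.-tuple R :=
  [tuple if i == j then x else tnth t i | i < m].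

Lemma tuple_upd_cons0 m (t : m.-tuple R) (a x : R) :
  tuple_upd (cons_tuple a t) ord0 x = cons_tuple x t.
Proof.
apply: eq_from_tnth => i; rewrite tnth_mktuple.
have [->|i0] := eqVneq i ord0; first by rewrite tnth0.
by case: (unliftP ord0 i) i0 => [k ->|-> /eqP//] _; rewrite !tnthS.
Qed.

Lemma tuple_upd_consS m (t : m.-tuple R) (a x : R) (j : 'I_m) :
  tuple_upd (cons_tuple a t) (lift ord0 j) x = cons_tuple a (tuple_upd t j x).
Proof.
apply: eq_from_tnth => i; rewrite tnth_mktuple.
case: (unliftP ord0 i) => [k ->|->]; last by rewrite !tnth0.
by rewrite !tnthS tnth_mktuple (inj_eq lift_inj).
Qed.

Lemma lebesgue_tupleS m (A : set (m.+1.-tuple Rm)) :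
  lebesgue_tuple m.+1 A =
  (@lebesgue_measure R \x lebesgue_tuple m)%E (@consp R m @^-1` A).
Proof. by []. Qed.

(** Induction on the dimension. If [j] is not the head coordinate, the slices with fixed head are
    null by induction; if it is, the slices along the head are countable. *)
Lemma lebesgue_tuple_countable_lines m (j : 'I_m) (N : set (m.-tuple Rm)) :
  measurable N -> (forall t, countable [set x | N (tuple_upd t j x)]) ->
  lebesgue_tuple m N = 0.
Proof.
elim: m j N => [[]//|m IH] j N mN cN.
rewrite lebesgue_tupleS.
have mN' : measurable (@consp R m @^-1` N).
  by rewrite -[X in measurable X]setTI; exact: measurable_consp.
have E a (t : m.-tuple Rm) : consp (a, t) = cons_tuple a t by exact: val_inj.
case: (unliftP ord0 j) cN => [k ->|->] cN.
  rewrite /product_measure1 integral0_eq// => a _ /=.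
  apply: (IH k); first exact: measurable_xsection.
  move=> t; apply: sub_countable (cN (cons_tuple a t)).
  apply: subset_card_le => x /=; rewrite /xsection /= inE /= E.
  by rewrite tuple_upd_consS.
(* The head has to be integrated first here, so the order of integration is exchanged by uniqueness
   of the product measure. *)
rewrite (@product_measure_unique _ _ _ _ _ _ _
  (@lebesgue_measure R \x^ lebesgue_tuple m)%E)//; last first.
  by move=> A B mA mB; exact: product_measure2E.
rewrite /= /product_measure2 integral0_eq// => t _ /=.
apply: countable_lebesgue_measure0.
apply: sub_countable (cN (cons_tuple 0 t)).
by apply: subset_card_le => x /=; rewrite /ysection /= inE /= E tuple_upd_cons0.
Qed.

(** Cubes, used to enclose the unit ball from inside and outside and so to show that its volume is
    positive and finite. *)
Definition tuple_box m (a : R) : set (m.-tuple Rm) :=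
  [set t | forall i, `|tnth t i| <= a].

Lemma measurable_tuple_box m a : measurable (@tuple_box m a).
Proof.
have -> : @tuple_box m a =
    \bigcap_(i : 'I_m) ((@tnth _ _ ^~ i) @^-1` `[- a, a]).
  apply/seteqP; split=> t h i; last first.
    by rewrite ler_norml; have := h i I; rewrite /= in_itv.
  by move=> _; rewrite /= in_itv/= -ler_norml; exact: h.
apply: fin_bigcap_measurable; first exact: finite_finset.
move=> i _; rewrite -[X in measurable X]setTI.
by apply: measurable_tnth => //; exact: measurable_itv.
Qed.

Lemma lebesgue_tuple_box m (a : R) : 0 < a ->
  lebesgue_tuple m (@tuple_box m a) = ((2 * a) ^+ m)%:E.
Proof.
move=> a0; elim: m => [|m IH].
  by rewrite /= diracE mem_set// => -[].
rewrite lebesgue_tupleS.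
have -> : @consp R m @^-1` @tuple_box m.+1 a = `[- a, a] `*` @tuple_box m a.
  apply/seteqP; split=> -[x t].
    move=> h; split=> [|i] /=.
      by have := h ord0; rewrite tnth0 in_itv/= ler_norml.
    have := h (lift ord0 i); rewrite tnthS.
    by congr (`|_| <= _); congr tnth; exact: val_inj.
  move=> [/= xa ta] i; case: (unliftP ord0 i) => [k ->|->].
    rewrite tnthS; have := ta k.
    by congr (`|_| <= _); congr tnth; exact: val_inj.
  by rewrite tnth0/= ler_norml; rewrite in_itv in xa.
rewrite product_measure1E//; last exact: measurable_tuple_box.
have l : lebesgue_measure (`[- a, a] : set R) = (2 * a)%:E.
  rewrite lebesgue_measure_itv/= lte_fin gtrN// -EFinD opprK.
  by rewrite mulr_natl mulr2n.
rewrite exprS EFinM; congr (_ * _)%E; [exact: l|exact: IH].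
Qed.

(** Sup norm balls are boxes, hence measurable for the product sigma-algebra, and countably many of
    them, with rational centres and radii [1 / (k + 1)], exhaust an open set. *)
Lemma open_measurable_tuple m (U : set 'rV[R]_m) : open U ->
  measurable (@row_of_tuple R m @^-1` U : set (m.-tuple Rm)).
Proof.
move=> oU.
pose B (p : 'rV[rat]_m * nat) := ball (map_mx ratr p.1 : 'rV[R]_m) p.2.+1%:R^-1.
have mB p : measurable (@row_of_tuple R m @^-1` B p : set (m.-tuple Rm)).
  have -> : @row_of_tuple R m @^-1` B p =
      \bigcap_(i : 'I_m) ((@tnth _ _ ^~ i) @^-1`
        (ball (ratr (p.1 ord0 i) : R) p.2.+1%:R^-1 : set R)).
    apply/seteqP; split=> t.
      by move=> [_ h] i _; have := h ord0 i; rewrite !mxE.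
    by move=> h; split=> // i0 i; rewrite (ord1 i0) !mxE; exact: h.
  apply: fin_bigcap_measurable; first exact: finite_finset.
  move=> i _; rewrite -[X in measurable X]setTI.
  apply: measurable_tnth => //; apply: open_measurable.
  exact: ball_open.
pose D := [set p | B p `<=` U].
have -> : @row_of_tuple R m @^-1` U =
    \bigcup_(p in D) (@row_of_tuple R m @^-1` B p).
  apply/seteqP; split=> t; last by move=> [p Dp /Dp].
  rewrite openE in oU; move=> /= /oU /nbhs_ballP [eps e0 xeU].
  set x := row_of_tuple t in xeU.
  pose k := Num.truncn (eps / 2)^-1.
  have ek : k.+1%:R^-1 < eps / 2.
    by rewrite invf_plt ?posrE ?divr_gt0// truncnS_gt.
  have k0 : 0 < k.+1%:R^-1 :> R by [].
  have hq j : exists q : rat, ball (x ord0 j) k.+1%:R^-1 (ratr q : R).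
    have xx : x ord0 j - k.+1%:R^-1 < x ord0 j + k.+1%:R^-1.
      by rewrite ltrBlDr -addrA ltrDl addr_gt0.
    have [q] := rat_in_itvoo xx; rewrite in_itv/= => /andP[h1 h2]; exists q.
    by rewrite -ball_normE /= distrC ltr_norml ltrBrDl h1 ltrBlDl.
  have [q hqq] := choice hq.
  have Bx : B (\row_j q j, k) x.
    split=> // i0 j; rewrite (ord1 i0).
    by have := ball_sym (hqq j); rewrite !mxE.
  exists (\row_j q j, k); last exact: Bx.
  move=> y By; apply: xeU.
  apply: (@le_ball _ _ _ (k.+1%:R^-1 + k.+1%:R^-1)).
    by rewrite [leRHS]splitr lerD// ltW.
  by apply: ball_triangle By; exact: ball_sym.
rewrite bigcup_mkcond; apply: countable_bigcupT_measurable => [|p].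
  exact: countableP.
by case: ifP.
Qed.

Lemma closed_measurable_tuple m (A : set 'rV[R]_m) : closed A ->
  measurable (@row_of_tuple R m @^-1` A : set (m.-tuple Rm)).
Proof.
move=> cA; rewrite -[A]setCK preimage_setC; apply: measurableC.
exact: (open_measurable_tuple (closed_openC cA)).
Qed.

End lebesgue_tuple_theory.

(** * Steiner point *)

Section weighted_mean.
Context d {X : measurableType d} {R : realType} {m : nat}.
Variables (mu : {measure set X -> \bar R}) (D : set X) (v : R).
Hypotheses (mD : measurable D) (v0 : 0 < v) (muD : mu D = v%:E).
Implicit Types (g : X -> 'rV[R]_m) (u : 'rV[R]_m).

Definition bounded_measurable_row g := forall j,
  measurable_fun D (fun x => g x ord0 j) /\
  exists M, forall x, D x -> `|g x ord0 j| <= M.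

Definition mean_row g : 'rV[R]_m :=
  \row_j (v^-1 * \int[mu]_(x in D) g x ord0 j).

Lemma integrable_bounded_row g j : bounded_measurable_row g ->
  mu.-integrable D (EFin \o (fun x => g x ord0 j)).
Proof.
move=> /(_ j)[mg [M gM]]; apply: measurable_bounded_integrable => //.
  by rewrite muD ltry.
exists M; split; first by rewrite num_real.
by move=> y My x Dx; apply: le_trans (ltW My); exact: gM.
Qed.

(** A linear form commutes with the integral. The bound serves twice: half-spaces containing [C]
    contain the mean, and a mean tested against itself has its norm controlled. *)
Lemma mean_row_le g u k : bounded_measurable_row g ->
  (forall x, D x -> dotm u (g x) <= k) -> dotm u (mean_row g) <= k.
Proof.
move=> bg gk.
pose h j x := u ord0 j * g x ord0 j.
have hi j : mu.-integrable D (EFin \o h j).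
  have := integrableZl mD (u ord0 j) (integrable_bounded_row j bg).
  by apply: eq_integrable => // x _; rewrite /= EFinM.
have hs : mu.-integrable D (EFin \o (fun x => \sum_j h j x)).
  have := integrable_sum mD (index_enum 'I_m) (P := predT) (fun j _ => hi j).
  by apply: eq_integrable => // x _; rewrite /= sumEFin.
have -> : dotm u (mean_row g) = v^-1 * \int[mu]_(x in D) \sum_j h j x.
  rewrite /dotm big_ord1 /Rintegral.
  under eq_integral do rewrite -sumEFin.
  rewrite integral_sum//.
  rewrite (eq_bigr (fun j => (\int[mu]_(x in D) h j x)%:E)); last first.
    by move=> j _; rewrite fineK//; apply: integrable_fin_num => //; exact: hi.
  rewrite sumEFin/= mulr_sumr; apply: eq_bigr => j _.
  rewrite mxE mulrCA; congr (_ * _).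
  by rewrite -RintegralZl//; exact: integrable_bounded_row.
rewrite ler_pdivrMl//.
have -> : v * k = \int[mu]_(x in D) k by rewrite Rintegral_cst// muD mulrC.
apply: le_Rintegral => // [|x Dx].
  apply: measurable_bounded_integrable; rewrite ?muD ?ltry//.
  exact: bounded_cst.
by have := gk x Dx; rewrite /dotm big_ord1.
Qed.

Lemma mean_rowB f g : bounded_measurable_row f -> bounded_measurable_row g ->
  mean_row f - mean_row g = mean_row (fun x => f x - g x).
Proof.
move=> bf bg; apply/rowP => j; rewrite !mxE -mulrBr; congr (_ * _).
rewrite -RintegralB//; try exact: integrable_bounded_row.
by apply: eq_Rintegral => x _; rewrite !mxE.
Qed.

Lemma bounded_measurable_rowB f g :
  bounded_measurable_row f -> bounded_measurable_row g ->
  bounded_measurable_row (fun x => f x - g x).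
Proof.
move=> bf bg j; have [mf [M fM]] := bf j; have [mg [N gN]] := bg j.
split.
  rewrite (_ : (fun x => _) = (fun x => f x ord0 j) \- (fun x => g x ord0 j)).
    exact: measurable_funB.
  by apply/funext => x; rewrite !mxE.
exists (M + N) => x Dx; rewrite !mxE (le_trans (ler_normB _ _))//.
by rewrite lerD ?fM ?gN.
Qed.

End weighted_mean.

(* The nearest point projection of [s] onto [C] yields a separating direction
   when [s] is outside [C]. *)
Lemma convex_compact_mem {R : realType} {m n : nat} (C : set 'M[R]_(m, n)) s :
  Pck C ->
  (forall u k, (forall c, C c -> dotm u c <= k) -> dotm u s <= k) -> C s.
Proof.
move=> [C0 /convex_setP cvC cC] sep.
have ct : {within C, continuous (fun c => dotm (s - c) (s - c))}.
  by apply: continuous_subspaceT; exact: sqr_dist_continuous.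
have [p pC pmin] := compact_EVT_min C0 cC ct; rewrite inE in pC.
suff sp : s = p by rewrite sp.
apply/eqP; rewrite -subr_eq0; apply/eqP/enorm_eq0.
have /sep : forall c, C c -> dotm (s - p) c <= dotm (s - p) p.
  move=> c Cc; rewrite -subr_le0 -dotmBr leNgt; apply/negP.
  set a := dotm (s - p) (c - p) => a0.
  pose b := dotm (c - p) (c - p); have b0 : 0 <= b := dotmm_ge0 _.
  have ab0 : 0 < a + b by rewrite ltr_pwDl.
  (* For this [l], [l * b < 2 * a], so moving from [p] towards [c] by [l] comes strictly closer to
     [s]. The term [a] in the denominator keeps [l] at most 1. *)
  pose l := a / (a + b).
  have l0 : 0 < l by rewrite divr_gt0.
  have l1 : l <= 1 by rewrite ler_pdivrMr// mul1r lerDl.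
  have /mem_set/pmin := cvC c p l (ltW l0) l1 Cc pC.
  have -> : s - (l *: c + (1 - l) *: p) = (s - p) - l *: (c - p).
    by apply/matrixP => i j; rewrite !mxE; ring.
  have E (A B : 'M[R]_(m, n)) : dotm (A - l *: B) (A - l *: B) =
      dotm A A - 2 * l * dotm A B + l * (l * dotm B B).
    by rewrite dotmBr !dotmBl !dotmZr !dotmZl (dotmC B A); ring.
  rewrite E -/a -/b => H.
  have lab : l * (a + b) = a by rewrite divfK ?gt_eqF.
  have : 0 <= l * (l * b - 2 * a) by move: H; lra.
  by rewrite pmulr_rge0//; nra.
rewrite -subr_le0 -dotmBr => h.
have h2 : dotm (s - p) (s - p) = 0 by apply/eqP; rewrite eq_le h dotmm_ge0.
by rewrite /enorm h2 sqrtr0.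
Qed.

Lemma exposed_face_nonempty {R : realType} {m n : nat} (l : 'M[R]_(m, n))
  (C : set 'M[R]_(m, n)) : C !=set0 -> compact C -> exposed_face l C !=set0.
Proof.
move=> C0 cC.
have /(compact_EVT_max C0 cC)[c] : {within C, continuous (dotm l)}.
  by apply: continuous_subspaceT; exact: dotm_continuous.
rewrite inE => Cc h; exists c; split=> // x Cx; apply: h; exact: mem_set.
Qed.

(** The faces form the subdifferential of the support function, a monotone operator; the proof adds
    the two maximality inequalities. *)
Lemma exposed_face_monotone {R : realType} {m n : nat}
  (l l' c c' : 'M[R]_(m, n)) (C : set 'M[R]_(m, n)) :
  exposed_face l C c -> exposed_face l' C c' ->
  0 <= dotm (l' - l) (c' - c).
Proof.
move=> [Cc lc] [Cc' lc']; have := lc _ Cc'; have := lc' _ Cc.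
by rewrite dotmBl !dotmBr; lra.
Qed.

Lemma exposed_pointP {R : realType} {m n : nat} (l : 'M[R]_(m, n))
  (C : set 'M[R]_(m, n)) : exposing_directions C l ->
  exposed_face l C = [set exposed_point l C].
Proof.
move=> [c lc]; rewrite /exposed_point lc; congr [set _].
by have := @xgetPex _ 0 [set c] (ex_intro _ c erefl).
Qed.

(* A limit of directions [l] whose faces meet the closed set [D] is such a
   direction, since the relation "c is in the face of l" is closed and [C] is
   compact. *)
Lemma closed_face_meets {R : realType} {m n : nat} (C D : set 'M[R]_(m, n)) :
  compact C -> closed D -> closed [set l | exists2 c, exposed_face l C c & D c].
Proof.
move=> /compact_near_coveringP/near_covering_withinP cC cD.
rewrite -openC openE => l /= Hl.
have h : \forall l' \near l, C `<=` (fun c => ~ (exposed_face l' C c /\ D c)).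
  apply: (cC _ (nbhs l) (fun l' c => ~ (exposed_face l' C c /\ D c))) => c Cc.
  have [Dc|nDc] := pselect (D c).
    have [x Cx lx] : exists2 x, C x & dotm l c < dotm l x.
      apply: contrapT => hx; apply: Hl; exists c => //; split=> // x Cx.
      by rewrite leNgt; apply/negP => lx; apply: hx; exists x.
    have Fp : Filter (nbhs (c, l)) by exact: nbhs_filter.
    have op : nbhs (c, l) [set p | dotm p.2 p.1 < dotm p.2 x].
      pose fst_mx (p : 'M[R]_(m, n) * 'M[R]_(m, n)) := p.1.
      pose snd_mx (p : 'M[R]_(m, n) * 'M[R]_(m, n)) := p.2.
      have c1 : fst_mx @ nbhs (c, l) --> c by exact: cvg_fst.
      have c2 : snd_mx @ nbhs (c, l) --> l by exact: cvg_snd.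
      have cg := cvg_dotm Fp c2 (cvgB (cvg_cst x) c1).
      have : nbhs (dotm l (x - c)) [set y : R | 0 < y].
        apply: open_nbhs_nbhs; split; first exact: open_gt.
        by rewrite /= dotmBr subr_gt0.
      by move=> /cg; apply: (@filterS _ _ Fp) => p /=; rewrite dotmBr subr_gt0.
    apply: (@filterS _ _ Fp) op => -[c' l'] /= lt _ [[_ /(_ _ Cx)]].
    by rewrite leNgt lt.
  have : nbhs c (~` D).
    by apply: open_nbhs_nbhs; split=> //; exact: closed_openC.
  move=> nD; exists (~` D, setT); first by split=> //; exact: filterT.
  by move=> [c' l'] [/= nDc' _] _ [].
apply: (@filterS _ _ (nbhs_filter l)) h => l' hl' [c fc Dc].
by apply: (hl' c) => //; case: fc.
Qed.

(** * Null set of non-exposing directions, and estimates for the Steiner point *)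

Section steiner_point.
Context {R : realType} {m : nat}.
Local Notation Rm := (measurableTypeR R).
Implicit Types (A B C : set 'rV[R]_m).

Let pre A : set (m.-tuple Rm) := @row_of_tuple R m @^-1` A.
Let mu := lebesgue_tuple (R := R) m.

(** Splitting the non-exposing directions by coordinate lets each piece be studied along the lines
    of its own axis. *)
Definition coord_ambiguous C (j : 'I_m) : set 'rV[R]_m :=
  [set l | exists c c',
    [/\ exposed_face l C c, exposed_face l C c' & c ord0 j < c' ord0 j]].

Lemma closed_face_le C j (a : R) : compact C ->
  closed [set l | exists2 c, exposed_face l C c & c ord0 j <= a].
Proof.
move=> cC; apply: (@closed_face_meets _ _ _ C [set c | c ord0 j <= a]) => //.
have /continuous_closedP h := @coord_continuous R 1 m ord0 j.
exact: (h _ (@closed_le R a)).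
Qed.

Lemma closed_face_ge C j (a : R) : compact C ->
  closed [set l | exists2 c, exposed_face l C c & a <= c ord0 j].
Proof.
move=> cC; apply: (@closed_face_meets _ _ _ C [set c | a <= c ord0 j]) => //.
have /continuous_closedP h := @coord_continuous R 1 m ord0 j.
exact: (h _ (@closed_ge R a)).
Qed.

(** Two rationals inserted between the coordinates turn the strict inequality into a countable union
    of intersections of two closed sets. *)
Lemma measurable_coord_ambiguous C j : compact C ->
  measurable (pre (coord_ambiguous C j)).
Proof.
move=> cC.
pose M (p : rat * rat) :=
  [set l | exists2 c, exposed_face l C c & c ord0 j <= ratr p.1] `&`
  [set l | exists2 c, exposed_face l C c & ratr p.2 <= c ord0 j].
have -> : pre (coord_ambiguous C j) =
    \bigcup_(p in [set p | p.1 < p.2]) pre (M p).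
  apply/seteqP; split=> t /=.
    move=> [c [c' [fc fc' cc']]].
    have [p] := rat_in_itvoo cc'; rewrite in_itv/= => /andP[cp pc].
    have [q] := rat_in_itvoo pc; rewrite in_itv/= => /andP[pq qc].
    exists (p, q); first by move: pq; rewrite /= ltr_rat.
    by split; [exists c => //; exact: ltW|exists c' => //; exact: ltW].
  move=> [[p q] /= pq [[c fc cp] [c' fc' qc]]]; exists c, c'; split=> //.
  by apply: le_lt_trans cp (lt_le_trans _ qc); rewrite ltr_rat.
rewrite bigcup_mkcond; apply: countable_bigcupT_measurable => [|p].
  exact: countableP.
case: ifP => // _; rewrite /pre /M preimage_setI; apply: measurableI.
  exact: (closed_measurable_tuple (@closed_face_le C j (ratr p.1) cC)).
exact: (closed_measurable_tuple (@closed_face_ge C j (ratr p.2) cC)).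
Qed.

Lemma dotm_tuple_upd (t : m.-tuple R) j (x x' : R) (c : 'rV[R]_m) :
  dotm (row_of_tuple (tuple_upd t j x') - row_of_tuple (tuple_upd t j x)) c =
  (x' - x) * c ord0 j.
Proof.
rewrite /dotm big_ord1 (bigD1 j)//= big1 => [|i ij].
  by rewrite addr0 !mxE !tnth_mktuple eqxx.
by rewrite !mxE !tnth_mktuple (negbTE ij) subrr mul0r.
Qed.

(* On a line in direction [j] the ranges of the [j]-th coordinate of the faces
   are ordered by monotonicity; those with nonempty interior contain distinct
   rationals. *)
Lemma coord_ambiguous_line C j (t : m.-tuple R) :
  countable [set x | pre (coord_ambiguous C j) (tuple_upd t j x)].
Proof.
set S := [set x | _].
have hq x : exists q : rat, S x -> exists c c',
    [/\ exposed_face (row_of_tuple (tuple_upd t j x)) C c,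
        exposed_face (row_of_tuple (tuple_upd t j x)) C c',
        c ord0 j < ratr q & ratr q < c' ord0 j].
  have [[c [c' [fc fc' cc']]]|nS] := pselect (S x); last by exists 0.
  have [q] := rat_in_itvoo cc'; rewrite in_itv/= => /andP[cq qc].
  by exists q => _; exists c, c'.
have [q Hq] := choice hq.
have mono x x' : S x -> S x' -> x < x' -> q x < q x'.
  move=> /Hq[_ [c [_ fc _ qc]]] /Hq[c' [_ [fc' _ cq _]]] xx'.
  have := exposed_face_monotone fc fc'.
  rewrite dotm_tuple_upd pmulr_rge0 ?subr_gt0// !mxE subr_ge0 => cc'.
  by rewrite -(@ltr_rat R); apply: lt_le_trans qc (le_trans cc' (ltW cq)).
apply/countable_injP; exists (pickle \o q) => x x'.
rewrite !inE => Sx Sx' /= /(pcan_inj pickleK) qq.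
have [xx'|xx'|//] := ltgtP x x'.
  by have := mono _ _ Sx Sx' xx'; rewrite qq ltxx.
by have := mono _ _ Sx' Sx xx'; rewrite qq ltxx.
Qed.

Lemma exposing_directionsE C : C !=set0 -> compact C ->
  ~` exposing_directions C = \bigcup_j coord_ambiguous C j.
Proof.
move=> C0 cC; apply/seteqP; split=> l.
  move=> nl; have [c fc] := exposed_face_nonempty l C0 cC.
  apply: contrapT => h; apply: nl; exists c.
  apply/seteqP; split=> [c' fc'|_ ->//].
  apply/rowP => j; have [jj|jj|//] := ltgtP (c' ord0 j) (c ord0 j).
    by exfalso; apply: h; exists j => //; exists c', c.
  by exfalso; apply: h; exists j => //; exists c, c'.
move=> [j _ [c [c' [fc fc' cc']]]] [c0 h].
have ec : c = c0 by have : [set c0] c by rewrite -h.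
have ec' : c' = c0 by have : [set c0] c' by rewrite -h.
by move: cc'; rewrite ec ec' ltxx.
Qed.

Lemma measurable_nonexposing C : C !=set0 -> compact C ->
  measurable (pre (~` exposing_directions C)).
Proof.
move=> C0 cC; rewrite exposing_directionsE// /pre preimage_bigcup.
apply: countable_bigcupT_measurable => [|j]; first exact: countableP.
exact: measurable_coord_ambiguous.
Qed.

Lemma nonexposing_null C : C !=set0 -> compact C ->
  mu (pre (~` exposing_directions C)) = 0%E.
Proof.
move=> C0 cC; apply: measure_negligible; first exact: measurable_nonexposing.
rewrite exposing_directionsE// /pre preimage_bigcup.
(* Reindexing by [nat] gives the form of [negligible_bigcup]; each index carries one coordinate, or
   none from [m] on. *)
have -> : \bigcup_j pre (coord_ambiguous C j) =
    \bigcup_k \bigcup_(j in [set j : 'I_m | j = k :> nat])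
      pre (coord_ambiguous C j).
  apply/seteqP; split=> t; first by move=> [j _ h]; exists j => //; exists j.
  by move=> [k _ [j _ h]]; exists j.
apply: negligible_bigcup => k; have [km|mk] := ltnP k m; last first.
  rewrite (_ : \bigcup_(j in _) _ = set0); first exact: negligible_set0.
  apply/seteqP; split=> // t [j /= jk _].
  by move: (ltn_ord j); rewrite jk ltnNge mk.
rewrite (_ : \bigcup_(j in _) _ = pre (coord_ambiguous C (Ordinal km))).
  apply/negligibleP; first exact: measurable_coord_ambiguous.
  apply: (@lebesgue_tuple_countable_lines _ _ (Ordinal km)).
    exact: measurable_coord_ambiguous.
  exact: coord_ambiguous_line.
apply/seteqP; split=> t; last by move=> h; exists (Ordinal km).
by move=> [j /= jk]; rewrite (_ : j = Ordinal km)//; exact: val_inj.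
Qed.

Lemma unit_ball_closed : closed (@unit_ball R m).
Proof.
have -> : @unit_ball R m = [set x | dotm x x <= 1].
  apply/seteqP; split=> x /=; rewrite -sqr_enorm expr_le1//; exact: enorm_ge0.
have /continuous_closedP h :
    continuous (fun x : 'rV[R]_m => dotm (0 - x) (0 - x)).
  exact: sqr_dist_continuous.
have := h _ (@closed_le R 1); congr closed; apply/seteqP; split=> x /=;
  by rewrite sub0r -!sqr_enorm enormN.
Qed.

Lemma measurable_unit_ball : measurable (pre (@unit_ball R m)).
Proof. exact: (closed_measurable_tuple unit_ball_closed). Qed.

Lemma unit_ball_volumeP :
  mu (pre (@unit_ball R m)) = (unit_ball_volume m)%:E :> \bar R /\
  0 < unit_ball_volume m :> R.
Proof.
have le_norm (t : m.-tuple R) i : `|tnth t i| <= enorm (row_of_tuple t).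
  by have := entry_le_enorm (row_of_tuple t) ord0 i; rewrite mxE.
have upper : (mu (pre (@unit_ball R m)) <= ((2 * 1) ^+ m)%:E)%E.
  rewrite -(@lebesgue_tuple_box R m 1)//; apply: le_measure; rewrite ?inE.
  - exact: measurable_unit_ball.
  - exact: measurable_tuple_box.
  - by move=> t /= t1 i; apply: le_trans t1; exact: le_norm.
have fin : mu (pre (@unit_ball R m)) \is a fin_num.
  by rewrite ge0_fin_numE ?measure_ge0// (le_lt_trans upper)// ltry.
split; first by rewrite /unit_ball_volume fineK.
(* The Euclidean norm is at most [m] times the sup norm, so this cube lies in the ball; the
   successor covers [m = 0]. *)
pose a : R := m.+1%:R^-1.
have a0 : 0 < a by rewrite invr_gt0.
have lower : (((2 * a) ^+ m)%:E <= mu (pre (@unit_ball R m)))%E.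
  rewrite -(@lebesgue_tuple_box R m a)//; apply: le_measure; rewrite ?inE.
  - exact: measurable_tuple_box.
  - exact: measurable_unit_ball.
  move=> t ta; rewrite /pre /= /unit_ball /= (le_trans (enorm_le_normr _))//.
  have na : `|row_of_tuple t| <= a.
    apply: normr_le_entries => [|i j]; first exact: ltW.
    by rewrite mxE; exact: ta.
  rewrite mul1n (@le_trans _ _ (m%:R * a))//; first by rewrite ler_wpM2l.
  by rewrite /a ler_pdivrMr// mul1r ler_nat.
rewrite -lte_fin /unit_ball_volume fineK//; apply: lt_le_trans lower.
by rewrite lte_fin exprn_gt0// mulr_gt0.
Qed.

(** A common domain for the integrals of two bodies; for equal bodies it is the domain in the
    definition of [steiner]. *)
Definition steiner_domain A B : set (m.-tuple Rm) :=
  pre (exposing_directions A `&` exposing_directions B `&` @unit_ball R m).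

Let v : R := unit_ball_volume m.
Let y C (t : m.-tuple Rm) : 'rV[R]_m := exposed_point (row_of_tuple t) C.

Section two_bodies.
Variables A B : set 'rV[R]_m.
Hypotheses (A0 : A !=set0) (cA : compact A) (B0 : B !=set0) (cB : compact B).
Let D := steiner_domain A B.

Let DE : D = (pre (@unit_ball R m) `\` pre (~` exposing_directions A)) `\`
  pre (~` exposing_directions B).
Proof.
rewrite /D /steiner_domain; apply/seteqP; split=> t /=.
  by move=> [[h1 h2] h3]; split; [split=> // h; exact: h|move=> h; exact: h].
by move=> [[h1 /contrapT h2] /contrapT h3].
Qed.

Lemma measurable_steiner_domain : measurable D.
Proof.
rewrite DE; apply: measurableD; last exact: measurable_nonexposing.
by apply: measurableD;
  [exact: measurable_unit_ball|exact: measurable_nonexposing].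
Qed.

Let measureD_null (X N : set (m.-tuple Rm)) : measurable X -> measurable N ->
  mu N = 0%E -> mu (X `\` N) = mu X.
Proof.
move=> mX mN N0; apply/eqP; rewrite eq_le; apply/andP; split.
  by apply: le_measure; rewrite ?inE//; exact: measurableD.
have h : (mu X <= mu ((X `\` N) `|` N))%E.
  apply: le_measure; rewrite ?inE//.
    by apply: measurableU => //; exact: measurableD.
  by move=> t Xt; have [Nt|nNt] := pselect (N t); [right|left].
have mXN : measurable (X `\` N) by exact: measurableD.
apply: (le_trans h).
have add0 (a b c : \bar R) : (a <= b + c)%E -> c = 0%E -> (a <= b)%E.
  by move=> + c0; rewrite c0 adde0.
exact: (add0 _ _ _ (measureU2 mu mXN mN) N0).
Qed.

Lemma measure_steiner_domain : mu D = v%:E.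
Proof.
have [<- _] := unit_ball_volumeP.
have mA := measurable_nonexposing A0 cA.
have mB := measurable_nonexposing B0 cB.
rewrite DE measureD_null//; last exact: nonexposing_null.
  by rewrite measureD_null//;
    [exact: measurable_unit_ball|exact: nonexposing_null].
by apply: measurableD => //; exact: measurable_unit_ball.
Qed.

(** Ensures that the supremum in [demyanov_dist] is not over the empty set, where it would be
    [-oo]. *)
Lemma steiner_domain_nonempty : D !=set0.
Proof.
apply/set0P/negP => /eqP D0; have := measure_steiner_domain.
rewrite D0 measure0 => /eqP; rewrite eqe lt_eqF//.
by have [] := unit_ball_volumeP.
Qed.

(** On exposing directions a coordinate of the exposed point is at least [a] exactly when the face
    meets a closed half-space, which is a closed condition on the direction. *)
Lemma bounded_measurable_exposed C (E : set (m.-tuple Rm)) :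
  C !=set0 -> compact C ->
  measurable E -> E `<=` pre (exposing_directions C) ->
  bounded_measurable_row E (y C).
Proof.
move=> C0 cC mE EC j; split; last first.
  have [M [_ hM]] := compact_bounded cC; exists (M + 1) => t Et.
  have /exposed_pointP fy := EC _ Et.
  have [Cy _] : exposed_face (row_of_tuple t) C (y C t) by rewrite fy.
  rewrite (le_trans (entry_le_normr _ _ _))//.
  by apply: hM => //; rewrite ltrDl.
apply: (measurability _ (RGenCInfty.measurableE R)).
move=> _ [_ [a ->] <-].
have -> : E `&` (fun t => y C t ord0 j) @^-1` `[a, +oo[ = E `&`
    pre [set l | exists2 c, exposed_face l C c & a <= c ord0 j].
  apply/seteqP; split=> t /= [Et h]; split=> //;
    have fy := exposed_pointP (EC _ Et).
    exists (y C t); first by rewrite fy.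
    by move: h; rewrite in_itv/= andbT.
  by move: h => [c]; rewrite fy => ->; rewrite in_itv/= andbT.
apply: measurableI => //.
exact: (closed_measurable_tuple (@closed_face_ge C j a cC)).
Qed.

End two_bodies.

Lemma steiner_domainC A B : steiner_domain A B = steiner_domain B A.
Proof. by rewrite /steiner_domain (setIC (exposing_directions A)). Qed.

(** Requiring the directions to expose [B] as well removes only a null set. *)
Lemma steiner_mean A B : A !=set0 -> compact A -> B !=set0 -> compact B ->
  steiner A = mean_row mu (steiner_domain A B) v (y A).
Proof.
move=> A0 cA B0 cB.
have AE : steiner_domain A A =
    @row_of_tuple R m @^-1` (exposing_directions A `&` @unit_ball R m).
  by rewrite /steiner_domain setIid.
have mD := measurable_steiner_domain A0 cA A0 cA.
have bA : bounded_measurable_row (steiner_domain A A) (y A).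
  by apply: bounded_measurable_exposed => //; rewrite AE => t [].
apply/rowP => j; rewrite !mxE -AE; congr (_ * fine _).
have iA := integrable_bounded_row mD (measure_steiner_domain A0 cA A0 cA) j bA.
rewrite (negligible_integral (measurable_nonexposing B0 cB) mD iA
  (nonexposing_null B0 cB)).
congr (integral _ _ _); apply/seteqP; split=> t.
  by move=> [[[h1 h2] h3] /contrapT h4].
by move=> [[h1 h2] h3]; split=> // h; exact: h.
Qed.

Lemma steiner_mem C : Pck C -> C (steiner C).
Proof.
move=> PC; have [C0 _ cC] := PC; apply: convex_compact_mem PC _ => u k uk.
rewrite (steiner_mean C0 cC C0 cC).
have mD := measurable_steiner_domain C0 cC C0 cC.
have [_ v0] := unit_ball_volumeP.
apply: (mean_row_le mD v0 (measure_steiner_domain C0 cC C0 cC)).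
  by apply: bounded_measurable_exposed => // t [[]].
move=> t [[Ct _] _]; apply: uk.
have [//] : exposed_face (row_of_tuple t) C (y C t).
by rewrite (exposed_pointP Ct).
Qed.

Lemma steiner_demyanov A B : Pck A -> Pck B ->
  (edistm (steiner A) (steiner B) <= demyanov_dist A B)%E.
Proof.
move=> [A0 _ cA] [B0 _ cB].
have up l : (exposing_directions A `&` exposing_directions B) l ->
    (edistm (exposed_point l A) (exposed_point l B) <= demyanov_dist A B)%E.
  by move=> ABl; apply: ereal_sup_ubound; exists l.
have [t0 [ABt0 _]] := steiner_domain_nonempty A0 cA B0 cB.
have := up _ ABt0; case: (demyanov_dist A B) up => [k up k0|_ _|_]; last by [].
  2: by rewrite leey.
move: k0; rewrite lee_fin => /(le_trans (enorm_ge0 _)) k0.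
rewrite /edistm lee_fin (steiner_mean A0 cA B0 cB) (steiner_mean B0 cB A0 cA).
rewrite (steiner_domainC B A).
have mD := measurable_steiner_domain A0 cA B0 cB.
have muD := measure_steiner_domain A0 cA B0 cB.
have [_ v0] := unit_ball_volumeP.
have bA : bounded_measurable_row (steiner_domain A B) (y A).
  by apply: bounded_measurable_exposed => // t [[]].
have bB : bounded_measurable_row (steiner_domain A B) (y B).
  by apply: bounded_measurable_exposed => // t [[]].
rewrite (mean_rowB mD muD bA bB); set z := mean_row _ _ _ _.
(* Testing the mean [z] against itself reduces the norm estimate to the scalar bound [mean_row_le];
   a factor [enorm z] then cancels. *)
have : dotm z z <= enorm z * k.
  apply: (mean_row_le mD v0 muD); first exact: bounded_measurable_rowB.
  move=> t [ABt _]; apply: (le_trans (cauchy_schwarz _ _)).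
  by rewrite ler_wpM2l ?enorm_ge0// -lee_fin; exact: up.
rewrite -sqr_enorm expr2; have := enorm_ge0 z.
rewrite le_eqVlt => /predU1P[<-//|z0].
by rewrite ler_pM2l.
Qed.

End steiner_point.

(** * Hoelder selections *)

Section vectorization.
Context {R : realType} {m n : nat}.
Implicit Types (A B C : set 'M[R]_(m, n)).

(** [steiner] lives on row vectors while [F] has matrix values. Flattening preserves the inner
    product, and thereby faces and distances. *)
Lemma dotm_mxvec (M N : 'M[R]_(m, n)) : dotm (mxvec M) (mxvec N) = dotm M N.
Proof.
rewrite /dotm big_ord1 pair_bigA (reindex _ (curry_mxvec_bij m n)) /=.
by apply: eq_bigr => -[i j] _; rewrite !mxvecE.
Qed.

Lemma dotm_vec_mx (l : 'rV[R]_(m * n)) (M : 'M[R]_(m, n)) :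
  dotm (vec_mx l) M = dotm l (mxvec M).
Proof. by rewrite -dotm_mxvec vec_mxK. Qed.

Lemma edistm_mxvec (M N : 'M[R]_(m, n)) :
  edistm (mxvec M) (mxvec N) = edistm M N.
Proof. by rewrite /edistm -linearB/= /enorm dotm_mxvec. Qed.

Lemma mxvec_continuous : continuous (@mxvec R m n).
Proof.
apply: (@lipschitz_mx_continuous _ _ _ _ _ (m * n)%:R) => // A B.
rewrite -linearB (le_trans (normr_le_enorm _))// /enorm dotm_mxvec.
exact: enorm_le_normr.
Qed.

Lemma Pck_mxvec C : Pck C -> Pck (mxvec @` C).
Proof.
move=> [[c Cc] /convex_setP cC kC]; split; first by exists (mxvec c), c.
  apply/convex_setP => _ _ l l0 l1 [x Cx <-] [y Cy <-].
  by exists (l *: x + (1 - l) *: y); [exact: cC|rewrite linearP linearZ].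
apply: continuous_compact => //; apply: continuous_subspaceT.
exact: mxvec_continuous.
Qed.

Lemma hausdorff_dist_mxvec A B :
  hausdorff_dist (mxvec @` A) (mxvec @` B) = hausdorff_dist A B.
Proof.
rewrite /hausdorff_dist !image_comp; congr maxe; congr ereal_sup.
  apply: eq_imagel => a _ /=; rewrite image_comp; congr ereal_inf.
  by apply: eq_imagel => b _ /=; exact: edistm_mxvec.
apply: eq_imagel => b _ /=; rewrite image_comp; congr ereal_inf.
by apply: eq_imagel => a _ /=; exact: edistm_mxvec.
Qed.

Lemma exposed_face_mxvec (l : 'rV[R]_(m * n)) C :
  exposed_face l (mxvec @` C) = mxvec @` exposed_face (vec_mx l) C.
Proof.
apply/seteqP; split=> [_ [[c Cc <-] h]|_ [c [Cc h] <-]].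
  exists c => //; split=> // x Cx.
  by rewrite !dotm_vec_mx; apply: h; exists x.
split; first by exists c.
by move=> _ [x Cx <-]; rewrite -!dotm_vec_mx; exact: h.
Qed.

Lemma exposing_directions_mxvec (l : 'rV[R]_(m * n)) C :
  exposing_directions (mxvec @` C) l ->
  exposing_directions C (vec_mx l) /\
  exposed_point l (mxvec @` C) = mxvec (exposed_point (vec_mx l) C).
Proof.
move=> lC; have fl := exposed_pointP lC; rewrite exposed_face_mxvec in fl.
have mem c : exposed_face (vec_mx l) C c ->
    mxvec c = exposed_point l (mxvec @` C).
  move=> fc; have : (mxvec @` exposed_face (vec_mx l) C) (mxvec c) by exists c.
  by rewrite fl.
have [c0 fc0 _] : (mxvec @` exposed_face (vec_mx l) C)
    (exposed_point l (mxvec @` C)) by rewrite fl.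
have Tl : exposing_directions C (vec_mx l).
  exists c0; apply/seteqP; split=> [c fc|_ ->//] /=.
  by apply: (can_inj mxvecK); rewrite (mem c)// (mem c0).
by split=> //; apply/esym/mem; rewrite (exposed_pointP Tl).
Qed.

Lemma demyanov_dist_mxvec A B :
  (demyanov_dist (mxvec @` A) (mxvec @` B) <= demyanov_dist A B)%E.
Proof.
apply: ge_ereal_sup => _ [l [lA lB] <-].
have [TA ->] := exposing_directions_mxvec lA.
have [TB ->] := exposing_directions_mxvec lB.
by rewrite edistm_mxvec; apply: ereal_sup_ubound; exists (vec_mx l).
Qed.

Lemma hausdorff_dist_ge0 A B : A !=set0 -> (0 <= hausdorff_dist A B)%E.
Proof.
move=> [a Aa]; rewrite le_max; apply/orP; left.
apply: (@le_trans _ _ (ereal_inf [set edistm a b | b in B])).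
  by apply: le_ereal_inf_tmp => _ [b _ <-]; rewrite lee_fin enorm_ge0.
by apply: ereal_sup_ubound; exists a.
Qed.

(** Compactness of [B] makes the distance from a point to [B] attained. This yields a constant
    selection when the Hausdorff seminorm vanishes. *)
Lemma hausdorff_dist_le0_sub A B : B !=set0 -> compact B ->
  (hausdorff_dist A B <= 0)%E -> A `<=` B.
Proof.
move=> B0 cB AB a Aa.
have ct : {within B, continuous (fun b => dotm (a - b) (a - b))}.
  by apply: continuous_subspaceT; exact: sqr_dist_continuous.
have [b Bb bmin] := compact_EVT_min B0 cB ct; rewrite inE in Bb.
suff ab : (edistm a b <= 0)%E.
  suff -> : a = b by [].
  apply/eqP; rewrite -subr_eq0; apply/eqP/enorm_eq0/eqP.
  by rewrite eq_le enorm_ge0 andbT -lee_fin.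
apply: le_trans AB; rewrite le_max; apply/orP; left.
apply: (@le_trans _ _ (ereal_inf [set edistm a b | b in B])).
  apply: le_ereal_inf_tmp => _ [c Bc <-]; rewrite lee_fin ler_sqrt ?dotmm_ge0//.
  by apply: bmin; exact: mem_set.
by apply: ereal_sup_ubound; exists a.
Qed.

End vectorization.

(** * Existence of a Hoelder selection *)

Section hoelder_selection.
Context {R : realType} {d e : nat}.
Variables (T alpha r : R) (F : R -> set 'M[R]_(e, d)).
Hypotheses (T0 : 0 < T) (alpha0 : 0 < alpha).
Hypothesis F_Pck : forall t, t \in `[0, T] -> Pck (F t).

(** As [0 < T], the pair [(0, T)] is admissible and bounds the supremum from below. *)
Lemma hoelder_seminorm_ge0 {X : Type} (dist : X -> X -> \bar R) (G : R -> X) :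
  (0 <= dist (G 0%R) (G T))%E -> (0 <= hoelder_seminorm dist alpha T G)%E.
Proof.
move=> h; apply: le_trans (ereal_sup_ubound _); last by exists (0, T); split.
by rewrite mule_ge0// lee_fin invr_ge0 powR_ge0.
Qed.

Lemma hoelder_selection_exists (f : R -> 'M[R]_(e, d)) :
  (forall t, 0 <= t <= T -> F t (f t)) ->
  (forall s t : R, 0 <= s -> s < t -> t <= T ->
    enorm (f s - f t) <= r * (t - s) `^ alpha) ->
  0 <= r /\ hoelder_selections T alpha r F !=set0.
Proof.
move=> fF fr.
have r0 : 0 <= r.
  have := le_trans (enorm_ge0 _) (fr 0 T (lexx _) T0 (lexx _)).
  by rewrite subr0 pmulr_lge0// powR_gt0.
by split=> //; exists f; apply/hoelder_selectionsP.
Qed.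

Lemma hoelder_selections_nonempty :
  (hoelder_seminorm hausdorff_dist alpha T F < +oo)%E ->
  (rmin T alpha F <= r%:E)%E ->
  0 <= r /\ hoelder_selections T alpha r F !=set0.
Proof.
move=> Foo; rewrite ge_min.
have FP t : 0 <= t <= T -> Pck (F t) by move=> tT; apply: F_Pck; rewrite in_itv.
have z0 : 0 <= (0 : R) <= T by rewrite lexx ltW.
pose f t := vec_mx (steiner (mxvec @` F t)).
have fF t : 0 <= t <= T -> F t (f t).
  move=> /FP/Pck_mxvec/steiner_mem[c Fc cE].
  by rewrite /f -cE mxvecK.
have fE s t : edistm (f s) (f t) =
    edistm (steiner (mxvec @` F s)) (steiner (mxvec @` F t)).
  by rewrite -edistm_mxvec !vec_mxK.
have itv (s t : R) : 0 <= s -> s < t -> t <= T ->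
    (0 <= s <= T) /\ (0 <= t <= T).
  by move=> s0 st tT; rewrite s0 tT (le_trans s0 (ltW st)) (le_trans (ltW st)).
move=> /orP[|/(hoelder_seminormP demyanov_dist alpha T r) Dr]; last first.
  apply: (hoelder_selection_exists fF) => s t s0 st tT.
  have [sT tT'] := itv _ _ s0 st tT.
  rewrite -lee_fin -/(edistm (f s) (f t)) fE; apply: le_trans (Dr s t s0 st tT).
  apply: le_trans (demyanov_dist_mxvec _ _).
  by apply: steiner_demyanov; apply: Pck_mxvec; exact: FP.
have h0 : (0 <= hoelder_seminorm hausdorff_dist alpha T F)%E.
  by apply: hoelder_seminorm_ge0; apply: hausdorff_dist_ge0; have [] := FP 0 z0.
have [h hE] : exists h : R, hoelder_seminorm hausdorff_dist alpha T F = h%:E.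
  exists (fine (hoelder_seminorm hausdorff_dist alpha T F)).
  by rewrite fineK// ge0_fin_numE.
have /(hoelder_seminormP hausdorff_dist alpha T h) Fh :
    (hoelder_seminorm hausdorff_dist alpha T F <= h%:E)%E by rewrite hE.
rewrite hE lee_fin le_eqVlt in h0; rewrite hE; move: h0 => /predU1P[h0|h0].
  (* As [+oo * 0 = 0], the bound carries no Lipschitz information here; but
     [F] is constant. *)
  rewrite -h0 mule0 lee_fin => r0; have [[c Fc] _ _] := FP 0 z0.
  apply: (@hoelder_selection_exists (fun=> c)) => [t /andP[]|s t s0 st tT].
    rewrite le_eqVlt => /predU1P[<-//|t0] tT.
    have [|Ft0 _ cFt] := FP t; first by rewrite (ltW t0).
    apply: hausdorff_dist_le0_sub Fc => //.
    by rewrite (le_trans (Fh 0 t _ t0 tT))// -h0 mul0r.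
  by rewrite subrr enorm0 mulr_ge0// powR_ge0.
(* With [h > 0] the hypothesis bounds the infimum of the Lipschitz constants by [r / h]. It remains
   to see that the distance of the two Steiner points, divided by [h] and the power of [t - s], is a
   lower bound of these constants. *)
rewrite -lee_pdivlMr// => Kr.
apply: (hoelder_selection_exists fF) => s t s0 st tT.
have [sT tT'] := itv _ _ s0 st tT.
have ts : 0 < (t - s) `^ alpha by rewrite powR_gt0// subr_gt0.
rewrite -ler_pdivrMr// -[r](divfK (lt0r_neq0 h0)) -ler_pdivrMr//.
rewrite -lee_fin EFinM; apply: le_trans Kr.
apply: le_ereal_inf_tmp => _ [k [k0 kK] <-].
rewrite lee_fin !ler_pdivrMr// -lee_fin -/(edistm (f s) (f t)) fE.
have PA := Pck_mxvec (FP _ sT); have PB := Pck_mxvec (FP _ tT').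
apply: le_trans (kK _ _ PA PB) _; rewrite hausdorff_dist_mxvec -mulrA EFinM.
by rewrite lee_wpmul2l ?lee_fin//; exact: Fh.
Qed.

End hoelder_selection.

Unset Implicit Arguments.

Theorem proposition3p10 (R : realType) (T : R) (hT : 0 < T)
    (d e : nat) (hd : (0 < d)%N) (he : (0 < e)%N)
    (alpha beta : R) (halpha : 0 < alpha <= 1) (hbeta : 0 < beta <= 1)
    (halphabeta : 1 < alpha + beta)
    (F : R -> set 'M[R]_(e, d)) (hF : forall t, t \in `[0, T] -> Pck (F t))
    (hFalpha : (hoelder_seminorm hausdorff_dist alpha T F < +oo)%E)
    (w : R -> 'cV[R]_d) (hw : (hoelder_seminorm edistm beta T w < +oo)%E)
    (r : R) (hr : (rmin T alpha F <= r%:E)%E) :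
  [/\ aumann_young T alpha r F w !=set0,
      bounded_set (aumann_young T alpha r F w),
      closed (aumann_young T alpha r F w)
    & convex_set (aumann_young T alpha r F w : set (convex_lmodType 'cV[R]_e))].
Proof.
have /andP[alpha0 _] := halpha; have /andP[beta0 _] := hbeta.
have [r0 S0] := hoelder_selections_nonempty hT alpha0 hF hFalpha hr.
have w0 : (0 <= hoelder_seminorm edistm beta T w)%E.
  by apply: hoelder_seminorm_ge0 => //; rewrite lee_fin enorm_ge0.
pose W := fine (hoelder_seminorm edistm beta T w).
have W0 : 0 <= W by rewrite fine_ge0.
have wW : hoelder_on T beta W w.
  by apply: hoelder_edistm_on => //; rewrite fineK// ge0_fin_numE.
split.
- exact: (aumann_young_nonempty hT alpha0 beta0 halphabeta W0 r0 wW S0).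
- exact: (aumann_young_bounded hT alpha0 beta0 halphabeta W0 r0 wW hF).
- exact: (aumann_young_closed hT alpha0 beta0 halphabeta W0 r0 wW hF).
- exact: (aumann_young_convex hT alpha0 r0 hF).
Qed.
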